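(* Let $D$ be a Dedekind domain (not a field) with quotient field $K$. For any $\mathcal{X} \subseteq \mathcal{Z}(\operatorname{Max}(D))$, let $$\mathcal{X}^\preceq = \{g \in \mathcal{Z}(\operatorname{Max}(D)): g \preceq f \text{ for some } f \in \mathcal{X}\},$$ $$\mathcal{X}^{\inf} = \{\inf \mathcal{Y}: \mathcal{Y} \subseteq \mathcal{X} \text{ and } \inf \mathcal{Y} \in \mathcal{Z}(\operatorname{Max}(D))\},$$ and let $[\mathcal{X}] = \{[f] : f \in \mathcal{X}\}$ denote the image of $\mathcal{X}$ under the map $[-]: \mathcal{Z}(\operatorname{Max}(D)) \to \mathcal{K}(D)$. (1) $\mathcal{X}^\dagger = (\mathcal{X}^\preceq)^{\inf}$ is the smallest subset of $\mathcal{Z}(\operatorname{Max}(D))$ containing $\mathcal{X}$ such that $[\mathcal{X}^\dagger] = \mathcal{K}(D)^\star$ for some semistar operation $\star$ on $D$. (2) The self-map $\dagger$ of $2^{\mathcal{Z}(\operatorname{Max}(D))}$ acting by $\mathcal{X} \mapsto \mathcal{X}^\dagger$ is a closure operation on $2^{\mathcal{Z}(\operatorname{Max}(D))}$. (3) $\mathcal{X} \in (2^{\mathcal{Z}(\operatorname{Max}(D))})^\dagger$ if and only if $\mathcal{X}^\preceq \subseteq \mathcal{X}$ and $\mathcal{X}^{\inf} \subseteq \mathcal{X}$. (4) The map $(2^{\mathcal{Z}(\operatorname{Max}(D))})^\dagger \to \mathsf{M}(\mathcal{K}(D))$ acting by $\mathcal{X} \mapsto [\mathcal{X}]$ is an isomorphism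 of posets (both sides being ordered by inclusion); explicitly, this isomorphism acts by $$\mathcal{X} \longmapsto \left\{\bigcap_{\mathfrak{p} \in \operatorname{Max}(D)} \mathfrak{p}^{-f(\mathfrak{p})} D_\mathfrak{p} : f \in \mathcal{X}\right\}$$ with inverse acting by $$\mathcal{C} \longmapsto \{(\mathfrak{p} \longmapsto -v_\mathfrak{p}(I)): I \in \mathcal{C}\}.$$
   Context: Closure operations: a closure operation on a poset $S$ is a self-map $\star: x \mapsto x^\star$ of $S$ such that, for all $x,y\in S$: $x \leq x^\star$; $x \leq y$ implies $x^\star \leq y^\star$; $(x^\star)^\star = x^\star$. We write $S^\star = \{x^\star: x \in S\}$, the set of $\star$-closed elements. For a set $X$, $2^X$ is its power set ordered by inclusion. Semistar operations: for an integral domain $D$ with quotient field $K$, $\mathcal{K}(D)$ is the lattice of all nonzero $D$-submodules of $K$ ordered by inclusion. A semistar operation on $D$ is a closure operation $\star$ on $\mathcal{K}(D)$ with $I^\star J^\star \subseteq (IJ)^\star$ for all $I,J\in\mathcal{K}(D)$. Put $\mathsf{M}(\mathcal{K}(D)) = \{\mathcal{K}(D)^\star : \star \text{ a semistar operation on } D\}$, a subposet of $2^{\mathcal{K}(D)}$. Functions: $\mathbb{Z}[\infty] = \mathbb{Z}\cup\{\infty\}$ and $\mathbb{Z}[\pm\infty] = \mathbb{Z}\cup\{\pm\infty\}$ with their usual orders. For a set $S$, $\mathcal{Z}(S) = \{f: S \to \mathbb{Z}[\infty] : f^{-1}(\mathbb{Z}_{<0}) \text{ is finite}\} \subseteq \mathbb{Z}[\pm\infty]^S$,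 ordered pointwise. Infima $\inf\mathcal{Y}$ are taken pointwise in $\mathbb{Z}[\pm\infty]^S$; $\mathcal{Y}$ may be empty, with $\inf\emptyset$ the constant function $\infty$. For $f,g \in \mathbb{Z}[\pm\infty]^S$ write $f\preceq g$ if $f(x)\leq g(x)$ for all but finitely many $x\in S$ and, for all $x \in S$, $f(x)=\infty$ if and only if $g(x) = \infty$. Dedekind domains: $\operatorname{Max}(D)$ is the set of maximal ideals of $D$. For $\mathfrak{p}\in\operatorname{Max}(D)$ put $\mathfrak{p}^{\infty}D_\mathfrak{p} = (0)$ and $\mathfrak{p}^{-\infty}D_\mathfrak{p} = K$; for $I\in\mathcal{K}(D)$ define $v_\mathfrak{p}(I) \in \mathbb{Z}\cup\{\pm\infty\}$ by $ID_\mathfrak{p} = \mathfrak{p}^{v_\mathfrak{p}(I)}D_\mathfrak{p}$. For $f: \operatorname{Max}(D)\to\mathbb{Z}[\pm\infty]$ put $[f] = \bigcap_{\mathfrak{p}\in\operatorname{Max}(D)} \mathfrak{p}^{-f(\mathfrak{p})}D_\mathfrak{p}$. The map $f\mapsto [f]$ restricts to a bijection $\mathcal{Z}(\operatorname{Max}(D)) \to \mathcal{K}(D)$. *)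

(* Defs.v *)
From HB Require Import structures.
From mathcomp Require Import all_boot all_order all_algebra.
From mathcomp Require Import boolp classical_sets functions cardinality.
From mathcomp Require Import constructive_ereal.

Set Implicit Arguments.
Unset Strict Implicit.
Unset Printing Implicit Defensive.
Import Order.TTheory GRing.Theory Num.Theory.
Local Open Scope classical_set_scope.
Local Open Scope ring_scope.

(* A poset [S] is given as a subset [A] of an ambient [porderType] [T], and a
   self-map of [S] as a map [T -> T] preserving [A]; its values outside [A] are
   irrelevant.  The set of closed elements of such a map [c] is [c @` A]. *)

Definition closure_operation d (T : porderType d) (A : set T) (c : T -> T) :=
  [/\ set_fun A A c,
      forall x, A x -> (x <= c x)%O,
      forall x y, A x -> A y -> (x <= y)%O -> (c x <= c y)%O &
      forall x, A x -> c (c x) = c x].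

Definition poset_isomorphism d d' (T : porderType d) (T' : porderType d')
    (A : set T) (B : set T') (f : T -> T') :=
  set_bij A B f /\
  forall x y, A x -> A y -> (x <= y)%O <-> (f x <= f y)%O.

Definition inverse_on (T T' : Type) (A : set T) (B : set T')
    (f : T -> T') (g : T' -> T) :=
  [/\ set_fun B A g, forall x, A x -> g (f x) = x &
      forall y, B y -> f (g y) = y].

Section Ideals.
Variable D : idomainType.

Definition ideal (I : set D) :=
  [/\ I 0, forall x y, I x -> I y -> I (x + y) &
      forall a x, I x -> I (a * x)].

Definition prime_ideal (P : set D) :=
  [/\ ideal P, P <> setT & forall x y, P (x * y) -> P x \/ P y].

Definition maximal_ideal (P : set D) :=
  [/\ ideal P, P <> setT &
      forall J, ideal J -> P `<=` J -> J = P \/ J = setT].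

Definition noetherian :=
  forall I, ideal I -> exists s : seq D, I = smallest ideal [set` s].

Definition integrally_closed :=
  forall x : {fraction D}, integralOver (@tofrac D) x -> range (@tofrac D) x.

Definition dedekind_domain :=
  [/\ noetherian, integrally_closed &
      forall P, prime_ideal P -> P <> [set 0] -> maximal_ideal P].

Definition Max : set (set D) := [set P | maximal_ideal P].

End Ideals.

Arguments Max : clear implicits.

Section Submodules.
Variable D : idomainType.
Local Notation K := {fraction D}.
Local Notation iota := (@tofrac D).

Definition submodule (I : set K) :=
  [/\ I 0, forall x y, I x -> I y -> I (x + y) &
      forall (a : D) x, I x -> I (iota a * x)].

Definition Kmod : set (set K) := [set I | submodule I /\ I <> [set 0]].

Definition mulm (I J : set K) : set K :=
  smallest submodule [set x * y | x in I & y in J].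

Definition invm (I : set K) : set K :=
  [set x | forall y, I y -> range iota (x * y)].

(* I^0 is D *)
Fixpoint expm (I : set K) (n : nat) : set K :=
  if n is m.+1 then mulm I (expm I m) else range iota.

(* negative powers are powers of the inverse fractional ideal (D :_K I) *)
Definition expmz (I : set K) (z : int) : set K :=
  match z with
  | Posz n => expm I n
  | Negz n => expm (invm I) n.+1
  end.

Definition localization (P : set D) : set K :=
  [set iota a / iota s | a in setT & s in ~` P].

(* P^n D_P for n in Z, +oo or -oo *)
Definition locpow (P : set D) (n : \bar int) : set K :=
  match n with
  | z%:E%E => mulm (expmz (iota @` P) z) (localization P)
  | +oo%E => [set 0]
  | -oo%E => setT
  end.

(* v_P(I) is the n such that I D_P = P^n D_P; the default value [+oo] of [xget]
   is never used for I in K(D), D Dedekind and P maximal, as n then exists. *)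
Definition valuation (P : set D) (I : set K) : \bar int :=
  xget +oo%E [set n | mulm I (localization P) = locpow P n].

Definition semistar_operation (star : set K -> set K) :=
  closure_operation Kmod star /\
  forall I J, Kmod I -> Kmod J ->
    mulm (star I) (star J) `<=` star (mulm I J).

Definition MK : set (set (set K)) :=
  [set C | exists2 star, semistar_operation star & C = star @` Kmod].

End Submodules.

Arguments Kmod : clear implicits.
Arguments MK : clear implicits.

Section Functions.
Variable S : Type.
Implicit Types (f g : S -> \bar int) (X Y : set (S -> \bar int)).

Definition Zfun : set (S -> \bar int) :=
  [set f | (forall x, f x <> -oo%E) /\ finite_set [set x | (f x < 0)%E]].

(* [infimum +oo A] is [+oo] for [A] empty and the greatest lower bound of [A]
   otherwise *)
Definition finf Y : S -> \bar int :=
  fun x => infimum +oo%E [set f x | f in Y].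

Definition preceq f g :=
  finite_set [set x | ~~ (f x <= g x)%E] /\
  forall x, f x = +oo%E <-> g x = +oo%E.

Definition preceq_closure X := [set g | Zfun g /\ exists2 f, X f & preceq g f].

Definition inf_closure X :=
  [set g | Zfun g /\ exists2 Y, Y `<=` X & g = finf Y].

Definition dagger X := inf_closure (preceq_closure X).

End Functions.

Arguments Zfun : clear implicits.

Definition bracket (D : idomainType) (f : Max D -> \bar int) :
    set {fraction D} :=
  \bigcap_(p : Max D) locpow (\val p) (- f p)%E.

(* Main.v *)
Require Import Defs.
From HB Require Import structures.
From mathcomp Require Import all_boot all_order all_algebra.
From mathcomp Require Import generic_quotient.
From mathcomp Require Import boolp classical_sets functions cardinality.
From mathcomp Require Import constructive_ereal.

Set Implicit Arguments.
Unset Strict Implicit.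
Unset Printing Implicit Defensive.
Import Order.TTheory GRing.Theory Num.Theory.
Local Open Scope classical_set_scope.
Local Open Scope ring_scope.

(* For a maximal ideal [P], the ring [D_P] is a discrete valuation ring.
   Writing [nu P] for its valuation, [P^n D_P] is the set of the [x] with
   [n <= nu P x], so [bracket f] consists of the [x] with [- f p <= nu p x] for
   all [p], and intersections of submodules correspond to infima of functions.
   A family of nonzero submodules consists of the closed elements of a semistar
   operation iff it is stable under nonzero intersections and under
   multiplication by nonzero [x : K]; the latter replaces [f] by [f - ord x].
   Since [ord p x = 0] for almost all [p], [f - ord x] precedes [f].
   Conversely, weak approximation shows that every [g] preceding [f] is the
   infimum of the functions [f - ord x] lying above it.  Hence the semistar
   families correspond to the sets [X] stable under both closures, and
   [dagger X] is the least such set because the infimum closure of a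
   [preceq]-closed set is [preceq]-closed. *)

(** * Infima of functions and the two closures *)

(** A nonempty set of integers bounded below has a least element, so a finite infimum is attained.
    Without an integer lower bound the infimum is [-oo]; with one but no integer in [A] it is
    [+oo]. *)
Lemma bar_int_infimum (A : set (\bar int)) (m := infimum +oo%E A) :
  (forall n, (n <= m)%E <-> forall k, A k -> (n <= k)%E) /\
  (forall z, m = z%:E%E -> A m).
Proof.
suff [k [lbk gtk Ak]] : exists k, [/\ lbound A k,
    (forall n, lbound A n -> (n <= k)%E) & forall z, k = z%:E%E -> A k].
  have -> : m = k.
    rewrite /m /infimum; case: ifP => [/eqP A0|_].
      by apply/esym/eqP; rewrite -leye_eq; apply: gtk => n; rewrite A0.
    have infk : infimums A k by split=> // n; apply: gtk.
    exact: (is_subset1_infimums (xgetI +oo%E infk) infk).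
  split=> // n; split; last exact: gtk.
  by move=> nk j Aj; apply: (le_trans nk); apply: lbk.
have [[b lbb]|nlb] := pselect (exists b : int, lbound A b%:E%E); last first.
  exists -oo%E; split=> // [j _|[n| |] lbn //]; first exact: leNye.
    by case: nlb; exists n.
  by case: nlb; exists 0 => j /lbn; rewrite leye_eq => /eqP->; rewrite leey.
have [[z Az]|nA] := pselect (exists z : int, A z%:E%E); last first.
  exists +oo%E; split=> // [[n| |] Aj //|n _]; last exact: leey.
    by case: nA; exists n.
  by have := lbb _ Aj; rewrite leeNy_eq.
have bA y : A y%:E%E -> b <= y by move=> /lbb; rewrite lee_fin.
have exn : exists n : nat, `[< A (b + n%:Z)%:E%E >].
  exists `|z - b|%N; apply/asboolP.
  by rewrite gez0_abs ?subr_ge0 ?bA// (addrC b) subrK.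
case: (ex_minnP exn) => n /asboolP An minn.
exists (b + n%:Z)%:E%E; split=> // [[y| |] Aj|j]; last by move/(_ _ An).
- rewrite lee_fin -lerBrDl.
  have yb : 0 <= y - b by rewrite subr_ge0 bA.
  rewrite -(gez0_abs yb) lez_nat; apply: minn; apply/asboolP.
  by rewrite gez0_abs// (addrC b) subrK.
- exact: leey.
- by have := lbb _ Aj; rewrite leeNy_eq.
Qed.

Section FunctionClosures.
Variable S : Type.
Implicit Types (f g h : S -> \bar int) (X Y : set (S -> \bar int)).

Lemma le_finf Y p n : (n <= finf Y p)%E <-> forall f, Y f -> (n <= f p)%E.
Proof.
split=> [/(bar_int_infimum [set f p | f in Y]).1 nY f Yf|nY].
  by apply: nY; exists f.
by apply/(bar_int_infimum [set f p | f in Y]).1 => _ [f Yf <-]; apply: nY.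
Qed.

Lemma finf_attained Y p z : finf Y p = z%:E%E -> exists2 f, Y f & f p = z%:E%E.
Proof.
move=> Yz; have [f Yf fp] := (bar_int_infimum [set f p | f in Y]).2 _ Yz.
by exists f; rewrite // fp.
Qed.

Lemma inf_closureP X g : inf_closure X g <->
  Zfun S g /\ forall p z, g p = z%:E%E ->
    exists f, [/\ X f, forall q, (g q <= f q)%E & f p = z%:E%E].
Proof.
split=> [[Zg [Y YX gE]]|[Zg gX]]; split=> //.
  move=> p z; rewrite {1}gE => /finf_attained[f Yf fp].
  exists f; split=> // [|q]; first exact: YX.
  by rewrite gE; exact: ((le_finf Y q _).1 (lexx _) f Yf).
exists [set f | X f /\ forall q, (g q <= f q)%E]; first by move=> f [].
apply/funext => p; apply/eqP; rewrite eq_le; apply/andP; split.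
  by apply/le_finf => f [_]; apply.
case gp : (g p) => [z| |]; [|exact: leey|by case: (Zg.1 p)].
have [f [Xf gf <-]] := gX _ _ gp.
by apply: ((le_finf _ p _).1 (lexx _) f).
Qed.

Lemma sub_inf_closure X : X `<=` Zfun S -> X `<=` inf_closure X.
Proof.
by move=> XZ f Xf; apply/inf_closureP; split=> [|p z fp]; [exact: XZ|exists f].
Qed.

Lemma inf_closureS X Y : X `<=` Y -> inf_closure X `<=` inf_closure Y.
Proof.
move=> XY g /inf_closureP[Zg gX]; apply/inf_closureP; split=> // p z /gX[f].
by case=> /XY Yf gf fp; exists f.
Qed.

Lemma inf_closure_idem X : inf_closure (inf_closure X) `<=` inf_closure X.
Proof.
move=> g /inf_closureP[Zg gX]; apply/inf_closureP; split=> // p z.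
move=> /gX[f [/inf_closureP[_ fX] gf fp]].
have [h [Xh fh hp]] := fX _ _ fp.
by exists h; split=> // q; apply: le_trans (fh q).
Qed.

Lemma preceq_refl f : preceq f f.
Proof.
split=> //; rewrite (_ : [set _ | _] = set0)//.
by apply/seteqP; split=> x //=; rewrite lexx.
Qed.

Lemma preceq_trans f g h : preceq f g -> preceq g h -> preceq f h.
Proof.
move=> [fg fgy] [gh ghy]; split=> [|x]; last by rewrite fgy.
apply: (@sub_finite_set _ _
  ([set x | ~~ (f x <= g x)%E] `|` [set x | ~~ (g x <= h x)%E])).
  move=> x /= fh; have [fgx|] := boolP (f x <= g x)%E; [right|by left].
  by apply: contra fh; exact: le_trans.
by rewrite finite_setU.
Qed.

Lemma sub_preceq_closure X : X `<=` Zfun S -> X `<=` preceq_closure X.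
Proof.
by move=> XZ f Xf; split; [exact: XZ|exists f => //; exact: preceq_refl].
Qed.

Lemma preceq_closureS X Y : X `<=` Y -> preceq_closure X `<=` preceq_closure Y.
Proof. by move=> XY g [Zg [f /XY Yf gf]]; split=> //; exists f. Qed.

Lemma preceq_closure_idem X :
  preceq_closure (preceq_closure X) `<=` preceq_closure X.
Proof.
move=> g [Zg [f [_ [h Xh fh]] gf]]; split=> //; exists h => //.
exact: preceq_trans fh.
Qed.

(* If [g] is below [f] in the sense of [preceq] and [h] attains the infimum [f]
   at [p], then the function equal to [g] at [p] and to [max g h] elsewhere is
   below [h], attains [g] at [p] and dominates [g]. *)
Lemma preceq_inf_closure X : preceq_closure X `<=` X ->
  preceq_closure (inf_closure X) `<=` inf_closure X.
Proof.
move=> pX g [Zg [f /inf_closureP[Zf fX] [gf gfy]]].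
apply/inf_closureP; split=> // p z gp.
have [y fp] : exists y, f p = y%:E%E.
  case fp : (f p) => [y| |]; [by exists y| |by case: (Zf.1 p)].
  by have := (gfy p).2 fp; rewrite gp.
have [h [Xh fh hp]] := fX _ _ fp.
pose k q := if `[< q = p >] then g q else maxe (g q) (h q).
have gk q : (g q <= k q)%E.
  by rewrite /k; case: asboolP => _; rewrite ?lexx// le_max lexx.
have kp : k p = z%:E%E by rewrite /k; case: asboolP.
exists k; split=> //; apply: pX; split.
  split=> [q kq|]; first by have := gk q; rewrite kq leeNy_eq => /eqP; exact: Zg.1.
  by apply: sub_finite_set Zg.2 => q /=; exact: le_lt_trans.
exists h => //; split=> [|q].
  apply: (@sub_finite_set _ _ ([set p] `|` [set q | ~~ (g q <= f q)%E])).
    move=> q /=; rewrite /k; case: asboolP => [->|_]; first by left.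
    rewrite ge_max lexx andbT => gh; right; apply: contra gh => gfq.
    exact: le_trans (fh q).
  by rewrite finite_setU; split=> //; exact: finite_set1.
rewrite /k; case: asboolP => [->|_]; first by rewrite gp hp.
split; last by move=> ->; apply/eqP; rewrite -leye_eq le_max leey orbT.
rewrite /maxe /Order.max; case: ifP => // _ /gfy fq.
by apply/eqP; rewrite -leye_eq -fq.
Qed.

Lemma dagger_subZ X : dagger X `<=` Zfun S.
Proof. by move=> g []. Qed.

Lemma sub_dagger X : X `<=` Zfun S -> X `<=` dagger X.
Proof.
move=> XZ; apply: subset_trans (sub_preceq_closure XZ) _.
by apply: sub_inf_closure => g [].
Qed.

Lemma daggerS X Y : X `<=` Y -> dagger X `<=` dagger Y.
Proof. by move=> XY; apply/inf_closureS/preceq_closureS. Qed.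

Lemma inf_closure_dagger X : inf_closure (dagger X) `<=` dagger X.
Proof. exact: inf_closure_idem. Qed.

Lemma preceq_closure_dagger X : preceq_closure (dagger X) `<=` dagger X.
Proof. exact/preceq_inf_closure/preceq_closure_idem. Qed.

Lemma dagger_min X Y : X `<=` Y -> preceq_closure Y `<=` Y ->
  inf_closure Y `<=` Y -> dagger X `<=` Y.
Proof.
move=> XY pY iY; apply: subset_trans (daggerS XY) _.
exact: subset_trans (inf_closureS pY) iY.
Qed.

Lemma range_daggerP X : X `<=` Zfun S ->
  (@dagger S @` [set Y | Y `<=` Zfun S]) X <->
  preceq_closure X `<=` X /\ inf_closure X `<=` X.
Proof.
move=> XZ; split=> [[Y _ <-]|[pX iX]].
  by split; [exact: preceq_closure_dagger|exact: inf_closure_dagger].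
exists X => //; apply/seteqP; split; last exact: sub_dagger.
exact: dagger_min.
Qed.

Lemma dagger_closure : closure_operation [set X | X `<=` Zfun S] (@dagger S).
Proof.
split=> [X _|X XZ|X Y XZ YZ|X XZ]; rewrite ?subsetEset.
- exact: dagger_subZ.
- exact: sub_dagger.
- exact: daggerS.
- apply/seteqP; split; last exact/sub_dagger/dagger_subZ.
  by apply: dagger_min; [|exact: preceq_closure_dagger|
    exact: inf_closure_dagger].
Qed.

End FunctionClosures.

(** * Ideals of noetherian domains *)

Section NoetherianDomains.
Variable D : idomainType.
Local Notation K := {fraction D}.
Local Notation iota := (@tofrac D).
Implicit Types (I J P : set D) (a b d r s : D) (x y : K).

Lemma ideal1P I : ideal I -> (I 1 <-> I = setT).
Proof.
move=> [_ _ IM]; split=> [I1|->//]; apply/seteqP; split=> // a _.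
by rewrite -(mulr1 a); apply: IM.
Qed.

Lemma ideal_bigcup (G : set (set D)) : G !=set0 -> total_on G subset ->
  G `<=` (@ideal D) -> ideal (\bigcup_(I in G) I).
Proof.
move=> [I0 GI0] totG Gid; split=> [|a b [I GI Ia] [J GJ Jb]|a b [I GI Ib]].
- by exists I0 => //; case: (Gid _ GI0).
- have [IJ|JI] := totG _ _ GI GJ.
    by exists J => //; case: (Gid _ GJ) => _ JD _; apply: JD => //; apply: IJ.
  by exists I => //; case: (Gid _ GI) => _ ID _; apply: ID => //; apply: JI.
- by exists I => //; case: (Gid _ GI) => _ _; apply.
Qed.

(** Zorn's lemma applies: the union of a chain of ideals is finitely generated, and its generators
    already lie in one member of the chain. *)
Lemma noetherian_max (F : set (set D)) : noetherian D -> F `<=` (@ideal D) ->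
  F !=set0 -> exists2 M, F M & forall I, F I -> M `<=` I -> I = M.
Proof.
move=> nD Fid [I0 FI0].
have [|M [PM maxM]] := @Zorn_bigcup D [set A | A = set0 \/ F A].
  move=> G GF totG; have [[A [GA FA]]|nG] := pselect (exists A, G A /\ F A).
    right; pose G' := G `&` F.
    have GG' : \bigcup_(X in G) X = \bigcup_(X in G') X.
      apply/seteqP; split=> a [X GX Xa]; last by exists X => //; case: GX.
      by exists X => //; split=> //; case: (GF _ GX) => // X0; rewrite X0 in Xa.
    have totG' : total_on G' subset by move=> X Y [GX _] [GY _]; apply: totG.
    have idU : ideal (\bigcup_(X in G') X).
      by apply: ideal_bigcup => //; [exists A|move=> X [_ /Fid]].
    rewrite GG'; have [s sE] := nD _ idU.
    have [B [G'B sB]] : exists B, G' B /\ forall a, a \in s -> B a.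
      have : {subset s <= \bigcup_(X in G') X}.
        by move=> a as_; apply/mem_set; rewrite sE; apply: sub_gen_smallest.
      elim: (s) => [_|a t IHt tU]; first by exists A.
      have [|B [G'B tB]] := IHt.
        by move=> b bt; apply: tU; rewrite inE bt orbT.
      have /set_mem[C G'C Ca] := tU a (mem_head _ _).
      have [BC|CB] := totG' _ _ G'B G'C.
        exists C; split=> // b; rewrite inE => /predU1P[->//|bt].
        by apply: BC; apply: tB.
      exists B; split=> // b; rewrite inE => /predU1P[->//|bt]; first exact: CB.
      exact: tB.
    suff -> : \bigcup_(X in G') X = B by case: G'B.
    apply/seteqP; split; last by move=> a Ba; exists B.
    by rewrite sE; apply: smallest_sub; [apply: Fid; case: G'B|].
  left; apply/seteqP; split=> // a [X GX Xa].
  by case: (GF _ GX) => [X0|FX]; [rewrite -X0|case: nG; exists X].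
have FM : F M.
  case: PM => // M0; case: (maxM I0); last by right.
  by split; rewrite M0// => /(_ 0); apply; case: (Fid _ FI0).
exists M => // I FI MI; apply: contrapT => IM; apply: (maxM I); last by right.
by split=> // IM'; apply: IM; apply/seteqP.
Qed.

Lemma noetherian_chain (J : nat -> set D) : noetherian D ->
  (forall n, ideal (J n)) -> (forall m n, (m <= n)%N -> J m `<=` J n) ->
  exists N, forall n, J n `<=` J N.
Proof.
move=> nD idJ JS; have [| |_ [N _ <-] maxN] := @noetherian_max (range J) nD.
- by move=> _ [n _ <-].
- by exists (J 0%N), 0%N.
exists N => n; rewrite -(maxN (J (maxn n N))).
- by apply: JS; rewrite leq_maxl.
- by exists (maxn n N).
- by apply: JS; rewrite leq_maxr.
Qed.

(** The ideal [I + Da]. *)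
Definition adjoin I a : set D := [set b | exists r, I (b - r * a)].

Lemma adjoin_ideal I a : ideal I -> ideal (adjoin I a).
Proof.
move=> [I0 ID IM]; split=> [|b c [r Ib] [s Ic]|b c [r Ic]].
- by exists 0; rewrite mul0r subr0.
- exists (r + s); rewrite mulrDl opprD addrACA; exact: ID.
- by exists (b * r); rewrite -mulrA -mulrBr; apply: IM.
Qed.

Lemma sub_adjoin I a : I `<=` adjoin I a.
Proof. by move=> b Ib; exists 0; rewrite mul0r subr0. Qed.

Lemma mem_adjoin I a : ideal I -> adjoin I a a.
Proof. by move=> [I0 _ _]; exists 1; rewrite mul1r subrr. Qed.

Lemma maximal_prime P : maximal_ideal P -> prime_ideal P.
Proof.
move=> [idP PT maxP]; split=> // a b Pab.
have [Pa|nPa] := pselect (P a); first by left.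
have := maxP _ (adjoin_ideal a idP) (@sub_adjoin P a).
case=> [aP|]; first by case: nPa; rewrite -aP; apply: mem_adjoin.
move=> /(ideal1P (adjoin_ideal a idP)).2[r P1]; right.
have [_ PD PM] := idP; rewrite -(mul1r b) -(subrK (r * a) 1) mulrDl.
by apply: PD; [rewrite mulrC|rewrite -mulrA]; apply: PM.
Qed.

Lemma prime_ideal_mul P a b : prime_ideal P -> P (a * b) <-> P a \/ P b.
Proof.
move=> [[_ _ PM] _ prP]; split; first exact: prP.
by case=> [Pa|Pb]; [rewrite mulrC|]; apply: PM.
Qed.

Lemma exists_maximal_ideal I : noetherian D -> ideal I -> I <> setT ->
  exists2 P, maximal_ideal P & I `<=` P.
Proof.
move=> nD idI IT.
have [| |M [idM [MT IM]] maxM] :=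
  @noetherian_max [set J | ideal J /\ J <> setT /\ I `<=` J] nD.
- by move=> J [].
- by exists I; split=> //; split.
exists M => //; split=> // J idJ MJ.
have [JT|JT] := pselect (J = setT); [by right|left].
by apply: maxM => //; split=> //; split=> //; apply: subset_trans MJ.
Qed.

(** A nonzero nonunit would lie in a maximal ideal, which is zero. *)
Lemma maximal_eq0_field : (forall P, maximal_ideal P -> P = [set 0]) ->
  noetherian D -> GRing.field_axiom D.
Proof.
move=> max0 nD a a0; pose I := [set b | exists c, b = c * a].
have idI : ideal I.
  split=> [|_ _ [b ->] [c ->]|b _ [c ->]].
  - by exists 0; rewrite mul0r.
  - by exists (b + c); rewrite mulrDl.
  - by exists (b * c); rewrite mulrA.
have [IT|IT] := pselect (I = setT).
  have /(ideal1P idI).2[c c1] := IT.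
  by apply/unitrP; exists c; rewrite -c1 mulrC -c1.
have [P maxP IP] := exists_maximal_ideal nD idI IT.
have : P a by apply: IP; exists 1; rewrite mul1r.
by rewrite (max0 _ maxP) /= => a0'; rewrite a0' eqxx in a0.
Qed.

Lemma fractionP x : exists a b, b != 0 /\ x = iota a / iota b.
Proof.
have b0 := denom_ratioP (repr x).
exists \n_(repr x), \d_(repr x); split=> //.
apply: (canRL (mulfK _)); first by rewrite tofrac_eq0.
rewrite -[X in X * _]reprK; unlock FracField.tofrac.
rewrite -[LHS]FracField.pi_mul.
apply/eqmodP; rewrite /= FracField.equivfE /FracField.mulf.
by rewrite !numden_Ratio ?mulr1 ?oner_neq0// mulrC.
Qed.

(** The ideals [J N] of the [d] of the form [a * p(x)], with [p] of degree less than [N], stabilize.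
    Hence [a * x ^+ N] equals such an [a * p(x)], and cancelling [a] leaves a monic equation for
    [x]. *)
Lemma almost_integral x a : noetherian D -> integrally_closed D -> a != 0 ->
  (forall n, range iota (iota a * x ^+ n)) -> range iota x.
Proof.
move=> nD icD a0 ax; apply: icD.
pose ev (p : {poly D}) := (map_poly iota p).[x].
have evD p q : ev (p + q) = ev p + ev q by rewrite /ev rmorphD hornerD.
have evM c p : ev (c *: p) = iota c * ev p.
  by rewrite /ev -mul_polyC rmorphM /= map_polyC hornerM hornerC.
pose J N := [set d | exists2 p : {poly D},
  (size p <= N)%N & iota d = iota a * ev p].
have idJ N : ideal (J N).
  split=> [|b c [p sp bE] [q sq cE]|b c [p sp cE]].
  - by exists 0; rewrite ?size_poly0// /ev !rmorph0 horner0 mulr0.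
  - exists (p + q); last by rewrite evD mulrDr -bE -cE rmorphD.
    by rewrite (leq_trans (size_polyD _ _))// geq_max sp.
  - exists (b *: p); first exact: leq_trans (size_scale_leq _ _) _.
    by rewrite evM mulrCA -cE rmorphM.
have JS M N : (M <= N)%N -> J M `<=` J N.
  by move=> MN b [p sp bE]; exists p => //; apply: leq_trans MN.
have [N JN] := noetherian_chain nD idJ JS.
have [d _ dE] := ax N.
have [p sp dE'] : J N d.
  apply: (JN N.+1); exists 'X^N; first by rewrite size_polyXn.
  by rewrite dE /ev map_polyXn hornerXn.
have a0' : iota a != 0 by rewrite tofrac_eq0.
exists ('X^N - p).
  rewrite monicE lead_coefDl ?lead_coefXn// size_polyN size_polyXn.
  exact: leq_ltn_trans sp _.
rewrite /root rmorphB hornerD hornerN /= map_polyXn hornerXn subr_eq0.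
by apply/eqP/(mulfI a0'); rewrite -dE dE'.
Qed.

End NoetherianDomains.

(** * Localization of a Dedekind domain at a maximal ideal *)

Section Localization.
Variables (D : idomainType) (P : set D).
Hypothesis primeP : prime_ideal P.
Local Notation K := {fraction D}.
Local Notation iota := (@tofrac D).
Local Notation loc := (localization P).
Implicit Types (a b d r s : D) (x y : K).

Lemma prime_ideal0 : P 0. Proof. by case: primeP => -[]. Qed.

Lemma prime_idealN1 : ~ P 1.
Proof. by case: primeP => idP PT _ /(ideal1P idP). Qed.

Lemma prime_idealNM a b : ~ P a -> ~ P b -> ~ P (a * b).
Proof. by move=> Pa Pb /(prime_ideal_mul a b primeP)[]. Qed.

Lemma prime_ideal_neq0 s : ~ P s -> iota s != 0.
Proof.
by move=> Ps; rewrite tofrac_eq0; apply/eqP => s0; apply: Ps; rewrite s0;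
  exact: prime_ideal0.
Qed.

Lemma loc_iota a : loc (iota a).
Proof.
by exists a => //; exists 1; rewrite ?rmorph1 ?divr1//; exact: prime_idealN1.
Qed.

Lemma loc0 : loc 0. Proof. by rewrite -(rmorph0 iota); apply: loc_iota. Qed.

Lemma loc1 : loc 1. Proof. by rewrite -(rmorph1 iota); apply: loc_iota. Qed.

Lemma locM x y : loc x -> loc y -> loc (x * y).
Proof.
move=> [a _ [s Ps <-]] [b _ [t Pt <-]]; exists (a * b) => //.
by exists (s * t); [exact: prime_idealNM|rewrite !rmorphM/= mulf_div].
Qed.

Lemma locX x n : loc x -> loc (x ^+ n).
Proof.
move=> lx; elim: n => [|n IHn]; first exact: loc1.
by rewrite exprS; apply: locM.
Qed.

Lemma locD x y : loc x -> loc y -> loc (x + y).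
Proof.
move=> [a _ [s Ps <-]] [b _ [t Pt <-]]; exists (a * t + b * s) => //.
exists (s * t); first exact: prime_idealNM.
by rewrite rmorphD !rmorphM /= addf_div// prime_ideal_neq0.
Qed.

Lemma locV s : ~ P s -> loc (iota s)^-1.
Proof. by move=> Ps; exists 1 => //; exists s; rewrite // rmorph1 mul1r. Qed.

Lemma loc_inv_iota a : a != 0 -> loc (iota a)^-1 -> ~ P a.
Proof.
move=> a0 [b _ [s Ps]] /(canRL (mulfVK (prime_ideal_neq0 Ps))) bE Pa.
have : P (b * a) by apply/(prime_ideal_mul _ _ primeP); right.
suff -> : b * a = s by [].
apply/eqP; rewrite -tofrac_eq rmorphM/= bE mulrAC mulVf ?mul1r//.
by rewrite tofrac_eq0.
Qed.

End Localization.

(** * A uniformizer of the local ring *)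

Section LocalUniformizer.
Variables (D : idomainType) (P : set D).
Hypotheses (dD : dedekind_domain D) (maxP : maximal_ideal P).
Hypothesis P0 : P <> [set 0].
Local Notation K := {fraction D}.
Local Notation iota := (@tofrac D).
Local Notation loc := (localization P).
Implicit Types (a b d r s : D) (x y : K).

Let primeP := maximal_prime maxP.
Let nD : noetherian D. Proof. by case: dD. Qed.

Lemma maximal_ideal_nonzero : exists2 a, P a & a != 0.
Proof.
apply: contrapT => nP; apply: P0; apply/seteqP; split=> [a Pa|_ ->].
  by apply/eqP; apply: contrapT => /negP a0; apply: nP; exists a.
exact: prime_ideal0.
Qed.

(* A maximal element among the ideals [(a D_P : b)], with [0 != a] in [P] and
   [b] not in [a D_P], is prime, hence equal to [P]. *)
Lemma inverse_not_in_localization :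
  exists2 x, invm (iota @` P) x & ~ loc x.
Proof.
have [a Pa a0] := maximal_ideal_nonzero.
have a0' : iota a != 0 by rewrite tofrac_eq0.
pose I b := [set r | loc (iota (r * b) / iota a)].
have idI b : ideal (I b).
  split=> [|r s|c r]; rewrite /I /=.
  - by rewrite mul0r rmorph0 mul0r; exact: loc0.
  - by rewrite mulrDl rmorphD mulrDl; exact: locD.
  - move=> Ir; rewrite -mulrA rmorphM/= -mulrA.
    by apply: locM => //; exact: loc_iota.
have [| |M [b [bM ->]] maxM] :=
    @noetherian_max D [set J | exists b, ~ loc (iota b / iota a) /\ J = I b] nD.
- by move=> _ [b [_ ->]].
- exists (I 1); exists 1; split=> //; rewrite rmorph1 mul1r.
  by move=> /(loc_inv_iota primeP a0).
(* If [r * s] lies in [I b] but [r] does not, then [I (r * b)] is a member of the family containing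
   [I b]; so they agree, and [s] lies in [I b]. *)
have primeI : prime_ideal (I b).
  split=> // [IT|r s Irs].
    apply: bM; have : I b 1 by rewrite IT.
    by rewrite /I /= mul1r.
  have [Ir|Ir] := pselect (I b r); [by left|right].
  rewrite -(maxM (I (r * b))).
  - by rewrite /I /= mulrA (mulrC s).
  - by exists (r * b).
  - move=> c Ic; rewrite /I /= mulrCA rmorphM/= -mulrA.
    by apply: locM => //; exact: loc_iota.
have IP : I b `<=` P.
  move=> r Ir; apply: contrapT => Pr; apply: bM.
  have := locM primeP Ir (locV Pr).
  rewrite (_ : _ * _ = iota b / iota a)//.
  rewrite rmorphM/= mulrAC (mulrC (iota r)) mulfK//.
  exact: prime_ideal_neq0 primeP _ Pr.
have Ia : I b a.
  by rewrite /I /= rmorphM mulrAC divff// mul1r; exact: loc_iota.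
have maxI : maximal_ideal (I b).
  case: dD => _ _; apply => // I0.
  by have : I b a := Ia; rewrite I0 /= => a0e; rewrite a0e eqxx in a0.
have PI : P = I b.
  have [idP PT _] := maxP; case: maxI => _ _ /(_ _ idP IP)[//|PT'].
  by case: PT.
have [S PS] : exists s : seq D, P = smallest (@ideal D) [set` s].
  by apply: nD; case: maxP.
(* A product [t] of denominators serves all of the finitely many generators of [P] at once, so that
   [t * b / a] maps [P] into [D]. *)
have [t Pt tS] : exists2 t, ~ P t & forall r, r \in S ->
    range iota (iota (t * r * b) / iota a).
  have : {subset S <= I b}.
    by move=> r rS; apply/mem_set; rewrite -PI PS; apply: sub_gen_smallest.
  elim: (S) => [_|r T IHT rTI]; first by exists 1 => //; exact: prime_idealN1.
  have [|t Pt tT] := IHT.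
    by move=> s sT; apply: rTI; rewrite inE sT orbT.
  have /set_mem[c _ [u Pu cE]] := rTI r (mem_head _ _).
  have u0 := prime_ideal_neq0 primeP Pu.
  exists (t * u) => [|s]; first exact: prime_idealNM.
  rewrite inE => /predU1P[->|/tT[d _ dE]].
    exists (t * c) => //; rewrite -!mulrA 2!rmorphM/= (rmorphM _ u) -!mulrA.
    by rewrite -cE; congr (_ * _); rewrite [RHS]mulrCA divff ?mulr1.
  exists (u * d) => //; rewrite rmorphM/= dE mulrA -rmorphM/=.
  by rewrite mulrA mulrA (mulrC u).
exists (iota t * (iota b / iota a)).
  move=> _ [r Pr <-]; rewrite (_ : _ * iota r = iota (t * r * b) / iota a).
    pose J := [set r | range iota (iota (t * r * b) / iota a)].
    suff PJ : P `<=` J by exact: PJ.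
    rewrite PS; apply: smallest_sub; last exact: tS.
    split=> [|c d [c' _ cE] [d' _ dE]|c d [d' _ dE]]; rewrite /J /=.
    - by exists 0 => //; rewrite mulr0 mul0r !rmorph0 mul0r.
    - exists (c' + d') => //.
      by rewrite rmorphD/= cE dE mulrDr mulrDl rmorphD/= mulrDl.
    - exists (c * d') => //.
      by rewrite rmorphM/= dE (mulrCA t) -(mulrA c) [in RHS]rmorphM/= mulrA.
  by rewrite !rmorphM/= mulrA mulrAC; congr (_ / _); rewrite mulrAC.
move=> /(locM primeP (locV Pt)); rewrite mulKf//.
exact: prime_ideal_neq0 Pt.
Qed.

(** Take [x] in the inverse of [P] but outside [D_P]. If [x] mapped [P] into itself, all
    [a * x ^+ n] would lie in [D] for a nonzero [a] in [P], and [x] would be integral, hence in [D].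
    So some [x * pi] is outside [P], and [x] is the inverse of [pi] up to a unit of [D_P]. *)
Lemma uniformizer : exists pi u x,
  [/\ P pi, ~ P u, invm (iota @` P) x & x * iota pi = iota u].
Proof.
have [x xP nx] := inverse_not_in_localization.
apply: contrapT => nex; apply: nx.
have xPP a : P a -> exists2 b, P b & iota b = x * iota a.
  move=> Pa; have [|b _ bE] := xP (iota a); first by exists a.
  by exists b => //; apply: contrapT => Pb; apply: nex; exists a, b, x.
have [a Pa a0] := maximal_ideal_nonzero.
have axP n : exists2 b, P b & iota b = iota a * x ^+ n.
  elim: n => [|n [b Pb bE]]; first by exists a; rewrite // mulr1.
  have [c Pc cE] := xPP _ Pb; exists c => //.
  by rewrite cE bE exprS mulrCA.
have icD : integrally_closed D by case: dD.
have [|b _ <-] := almost_integral nD icD a0 (x := x); last exact: loc_iota.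
by move=> n; have [b _ bE] := axP n; exists b.
Qed.

End LocalUniformizer.

(** * The order function of the local ring *)

Section Orders.
Variables (D : idomainType) (P : set D).
Hypotheses (dD : dedekind_domain D) (maxP : maximal_ideal P).
Hypothesis P0 : P <> [set 0].
Local Notation K := {fraction D}.
Local Notation iota := (@tofrac D).
Local Notation loc := (localization P).
Implicit Types (a b d r s : D) (x y : K).

Let primeP := maximal_prime maxP.

(** The increasing ideals [J n] of the [c] with [c * pi ^+ n] in [d D_P] stabilize. If all powers of
    [pi] divided [d] in [D_P], this would make [pi] invertible there. *)
Lemma exists_notin_loc pi d : P pi -> pi != 0 -> d != 0 ->
  exists n, ~ loc (iota d / iota pi ^+ n).
Proof.
move=> Ppi pi0 d0; apply: contrapT => nloc.
have d0' : iota d != 0 by rewrite tofrac_eq0.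
have pi0' : iota pi != 0 by rewrite tofrac_eq0.
have locd n : loc (iota d / iota pi ^+ n).
  by apply: contrapT => dn; apply: nloc; exists n.
pose J n := [set c | loc (iota c * iota pi ^+ n / iota d)].
have idJ n : ideal (J n).
  split=> [|a b Ja Jb|a b Jb]; rewrite /J /=.
  - by rewrite rmorph0 !mul0r; exact: loc0.
  - by rewrite rmorphD !mulrDl; exact: locD.
  - by rewrite rmorphM/= -!mulrA; apply: locM; rewrite ?mulrA//; apply: loc_iota.
have JS m n : (m <= n)%N -> J m `<=` J n.
  move=> mn c Jc; rewrite /J /= -(subnK mn) exprD mulrCA -mulrA.
  by apply: locM => //; apply: locX => //; exact: loc_iota.
have nD : noetherian D by case: dD.
have [N JN] := noetherian_chain nD idJ JS.
have [c _ [s Ps]] := locd N.+1.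
have s0 := prime_ideal_neq0 primeP Ps.
move=> /(canRL (mulfVK s0)) cE.
have /(JN N.+1) : J N.+1 c.
  rewrite /J /= cE (mulrAC _ _ (iota pi ^+ N.+1)) mulfVK ?expf_neq0//.
  by rewrite mulrAC divff// mul1r; exact: loc_iota.
rewrite /J /= cE exprS invfM mulrA (mulrAC _ _ (iota pi ^+ N)).
rewrite mulfVK ?expf_neq0// (mulrAC _ _ (iota d)^-1) (mulrAC (iota d)) divff//.
rewrite mul1r => /(fun h => locM primeP h (locV Ps)); rewrite mulfK//.
by move=> /(loc_inv_iota primeP pi0).
Qed.

Definition loc_unit x := [/\ x != 0, loc x & loc x^-1].

Lemma loc_unitM x y : loc_unit x -> loc_unit y -> loc_unit (x * y).
Proof.
move=> [x0 lx lVx] [y0 ly lVy]; split; rewrite ?mulf_neq0 ?invfM//.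
  exact: locM.
exact: locM.
Qed.

Lemma loc_unitV x : loc_unit x -> loc_unit x^-1.
Proof. by case=> x0 lx lVx; split; rewrite ?invr_eq0 ?invrK. Qed.

Lemma loc_unit_iota s : ~ P s -> loc_unit (iota s).
Proof.
move=> Ps; split; [exact: prime_ideal_neq0 primeP _ Ps| |exact: locV].
exact: loc_iota.
Qed.

(* [0 <= v x] characterizes membership in [D_P] only for nonzero [x]: the value
   of [v] at [0] is arbitrary. *)
Definition is_ord (v : K -> int) :=
  [/\ forall x y, x != 0 -> y != 0 -> v (x * y) = v x + v y,
      forall x, x != 0 -> loc x <-> 0 <= v x,
      exists2 pi, P pi & iota pi != 0 /\ v (iota pi) = 1 &
      exists2 x, invm (iota @` P) x & x != 0 /\ v x = -1].

(** Each nonzero [x] is a unit of [D_P] times a unique integral power of [pi]; the exponent is its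
    order. *)
Lemma exists_ord : exists v, is_ord v.
Proof.
have [pi [u [x0 [Ppi Pu x0P x0pi]]]] := uniformizer dD maxP P0.
have u0 := prime_ideal_neq0 primeP Pu.
have pi0' : iota pi != 0.
  by apply: contra u0 => /eqP pi0; rewrite -x0pi pi0 mulr0.
have pi0 : pi != 0 by rewrite -tofrac_eq0.
have x00 : x0 != 0 by apply: contra u0 => /eqP x0E; rewrite -x0pi x0E mul0r.
have npi n : ~ loc (iota pi ^+ n.+1)^-1.
  move=> /(fun h => locM primeP h (locX primeP n (loc_iota primeP pi))).
  rewrite exprS invfM mulfVK ?expf_neq0//.
  by move=> /(loc_inv_iota primeP pi0).
have unit_pi (z : int) : loc_unit (iota pi ^ z) -> z = 0.
  by case: z => [[|n]|n] [_ lz lVz] //; case: (npi n).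
have dec_iota d : d != 0 -> exists z : int, loc_unit (iota d / iota pi ^ z).
  (* The exponent of [d] is one less than the least [n] with [d / pi ^+ n] outside [D_P]; that [n]
     is positive since [d] lies in [D_P]. *)
  move=> d0; have exn : exists n, `[< ~ loc (iota d / iota pi ^+ n) >].
    by have [n] := exists_notin_loc Ppi pi0 d0; exists n; apply/asboolP.
  case: (ex_minnP exn) => -[|n] /asboolP dn minn.
    by case: dn; rewrite divr1; exact: loc_iota.
  exists n; have [c _ [s Ps cE]] : loc (iota d / iota pi ^+ n).
    apply: contrapT => dn'; have /minn : `[< ~ loc (iota d / iota pi ^+ n) >].
      exact/asboolP.
    by rewrite ltnn.
  rewrite -exprnP -cE.
  have [Pc|Pc] := pselect (P c); last first.
    by apply: loc_unitM; [|apply: loc_unitV]; apply: loc_unit_iota.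
  (* For [c] in [P], [c / pi = c * x0 / u] has its numerator in [D] and its denominator outside [P],
     so one more power of [pi] could be divided out. *)
  case: dn; rewrite exprSr invfM mulrA -cE mulrAC; apply: locM => //.
    have [a _ ] := x0P (iota c) (ex_intro2 _ _ c Pc erefl) => aE.
    exists a => //; exists u => //; rewrite aE -x0pi invfM.
    by rewrite mulrA (mulrC x0) mulfK.
  exact: locV.
have dec x : x != 0 -> exists z : int, loc_unit (x / iota pi ^ z).
  have [a [b [b0 ->]]] := fractionP x => ab0.
  have a0 : a != 0 by apply: contra ab0 => /eqP->; rewrite rmorph0 mul0r.
  have [m am] := dec_iota _ a0; have [n bn] := dec_iota _ b0.
  exists (m - n).
  rewrite (_ : _ / _ = iota a / iota pi ^ m / (iota b / iota pi ^ n)).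
    by apply: loc_unitM => //; exact: loc_unitV.
  rewrite expfzDr// -invr_expz invf_div mulf_div invf_div mulf_div.
  by rewrite (mulrC (iota b)).
pose v x := xget 0 [set z : int | loc_unit (x / iota pi ^ z)].
have vP x : x != 0 -> loc_unit (x / iota pi ^ v x).
  by move=> /dec[z zx]; have := xgetI 0 (zx : [set z | _] z).
have v_uniq x z : loc_unit (x / iota pi ^ z) -> v x = z.
  move=> xz; have x0' : x != 0.
    by case: xz; rewrite mulf_eq0 negb_or => /andP[].
  apply/eqP; rewrite -subr_eq0; apply/eqP/unit_pi.
  have := loc_unitM xz (loc_unitV (vP _ x0')).
  rewrite (_ : _ * _ = iota pi ^ (v x - z))//.
  by rewrite expfzDr// -invr_expz invf_div mulrC mulrA mulfVK.
exists v; split.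
- move=> x y x0' y0'; apply: v_uniq; rewrite expfzDr// -mulf_div.
  by apply: loc_unitM; apply: vP.
- move=> x x0'; have [w0 lw lVw] := vP _ x0'.
  have xE : x = x / iota pi ^ v x * iota pi ^ v x.
    by rewrite mulfVK// expfz_neq0.
  split=> [lx|].
    case vx : (v x) => [//|n]; case: (npi n).
    have := locM primeP lx lVw; rewrite vx.
    by rewrite invf_div mulrC mulfVK.
  case: (v x) lw xE => // n lw -> _; apply: locM => //.
  by rewrite -exprnP; apply/locX/loc_iota.
- exists pi => //; split=> //; apply: v_uniq; rewrite expr1z divff//.
  by rewrite -(rmorph1 iota); apply/loc_unit_iota/prime_idealN1.
- exists x0 => //; split=> //; apply: v_uniq; rewrite exprN1 invrK x0pi.
  exact: loc_unit_iota.
Qed.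

End Orders.
(** The default is never taken when [D] is a Dedekind domain other than a field and [P] is maximal,
    by [exists_ord]. *)
Definition ord (D : idomainType) (P : set D) : {fraction D} -> int :=
  xget (fun=> 0) (is_ord P).

Definition nu (D : idomainType) (P : set D) (x : {fraction D}) : \bar int :=
  if x == 0 then +oo%E else (ord P x)%:E%E.

(** * Products and intersections of submodules *)

Section Submodules.
Variable D : idomainType.
Local Notation K := {fraction D}.
Local Notation iota := (@tofrac D).
Implicit Types (I J L : set K).

Lemma mulm_sub I J L : submodule L -> (forall x y, I x -> J y -> L (x * y)) ->
  mulm I J `<=` L.
Proof.
by move=> sL IJL; apply: smallest_sub => // _ [x Ix [y Jy <-]]; apply: IJL.
Qed.

Lemma mem_mulm I J x y : I x -> J y -> mulm I J (x * y).
Proof. by move=> Ix Jy; apply: sub_gen_smallest; exists x => //; exists y. Qed.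

Lemma submodule_bigcap (G : set (set K)) : G `<=` @submodule D ->
  submodule (\bigcap_(I in G) I).
Proof.
move=> Gs; split=> [I /Gs[]//|x y xG yG I GI|a x xG I GI].
  by case: (Gs _ GI) => _ ID _; apply: ID; [exact: xG|exact: yG].
by case: (Gs _ GI) => _ _ IM; apply: IM; exact: xG.
Qed.

Lemma Kmod_nonzero I : Kmod D I -> exists2 x, I x & x != 0.
Proof.
move=> [[I0 _ _] nI]; apply: contrapT => nex; apply: nI.
apply/seteqP; split=> [x Ix|_ ->//]; apply/eqP; apply: contrapT => /negP x0.
by apply: nex; exists x.
Qed.

Lemma KmodI I x : submodule I -> I x -> x != 0 -> Kmod D I.
Proof.
by move=> sI Ix x0; split=> // I0; move: Ix x0; rewrite I0 => ->; rewrite eqxx.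
Qed.

End Submodules.

(** * Powers of a maximal ideal and submodules in terms of its valuation *)

Section Valuation.
Variable D : idomainType.
Hypotheses (dD : dedekind_domain D) (nF : ~ GRing.field_axiom D).
Local Notation K := {fraction D}.
Local Notation iota := (@tofrac D).
Implicit Types (a b r s : D) (x y : K).

Let nD : noetherian D. Proof. by case: dD. Qed.

(** If the zero ideal were maximal, it would be the only maximal ideal, and [D] would be a field. *)
Lemma maximal_ideal_neq0 (P : set D) : maximal_ideal P -> P <> [set 0].
Proof.
move=> [idP PT maxP] P0; apply: nF; apply: maximal_eq0_field => // Q [idQ QT maxQ].
have [|//|//] := maxP _ idQ; last by rewrite P0.
by rewrite P0 => _ ->; case: idQ.
Qed.

Lemma exists_max : exists P : set D, maximal_ideal P.
Proof.
apply: contrapT => nP; apply: nF; apply: maximal_eq0_field => // Q maxQ.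
by case: nP; exists Q.
Qed.

Section LocalValuation.
Variable P : set D.
Hypothesis maxP : maximal_ideal P.
Local Notation loc := (localization P).
Let primeP := maximal_prime maxP.

Lemma ordP : is_ord P (ord P).
Proof. exact: xgetPex (exists_ord dD maxP (maximal_ideal_neq0 maxP)). Qed.

Lemma ordM x y : x != 0 -> y != 0 -> ord P (x * y) = ord P x + ord P y.
Proof. by case: ordP => + _ _ _; apply. Qed.

Lemma ord_one : ord P 1 = 0.
Proof.
apply: (@addrI _ (ord P 1)).
by rewrite -ordM ?mulr1 ?addr0// oner_neq0.
Qed.

Lemma ordV x : x != 0 -> ord P x^-1 = - ord P x.
Proof.
move=> x0; have Vx0 : x^-1 != 0 by rewrite invr_eq0.
by apply/eqP; rewrite -addr_eq0 -(ordM Vx0 x0) mulVf// ord_one.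
Qed.

Lemma ord_ge0 x : x != 0 -> loc x <-> 0 <= ord P x.
Proof. by case: ordP => _ + _ _; apply. Qed.

Lemma ord_iota_ge0 a : a != 0 -> 0 <= ord P (iota a).
Proof. by move=> a0; apply/ord_ge0; [rewrite tofrac_eq0|exact: loc_iota]. Qed.

Lemma ord_iota_eq0 s : ~ P s -> ord P (iota s) = 0.
Proof.
move=> Ps; have s0 := prime_ideal_neq0 primeP Ps.
have sD0 : s != 0 by rewrite -tofrac_eq0.
have : 0 <= ord P (iota s)^-1.
  by apply/(ord_ge0 (invr_neq0 s0)); exact: locV.
rewrite (ordV s0) oppr_ge0 => os.
by apply/eqP; rewrite eq_le os (ord_iota_ge0 sD0).
Qed.

Lemma exists_ord_eq (z : int) : exists2 x, x != 0 & ord P x = z.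
Proof.
have [_ _ [pi _ [pi0 ord_pi]] _] := ordP.
have ordX n : ord P (iota pi ^+ n) = n.
  elim: n => [|n IHn]; first exact: ord_one.
  by rewrite exprS ordM ?expf_neq0// IHn ord_pi.
case: z => n; first by exists (iota pi ^+ n); rewrite ?expf_neq0.
exists (iota pi ^+ n.+1)^-1; first by rewrite invr_eq0 expf_neq0.
by rewrite ordV ?expf_neq0// ordX NegzE.
Qed.

Lemma nuE x : x != 0 -> nu P x = (ord P x)%:E%E.
Proof. by rewrite /nu => /negPf->. Qed.

Lemma nu0 : nu P 0 = +oo%E. Proof. by rewrite /nu eqxx. Qed.

Lemma nuM x y : y != 0 -> nu P (x * y) = (nu P x + (ord P y)%:E)%E.
Proof.
move=> y0; have [->|x0] := eqVneq x 0; first by rewrite mul0r nu0.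
by rewrite !nuE ?mulf_neq0// ordM.
Qed.

Lemma nu_ge0 x : loc x <-> (0 <= nu P x)%E.
Proof.
have [->|x0] := eqVneq x 0.
  by rewrite nu0 leey; split=> // _; exact: loc0.
by rewrite nuE// lee_fin; exact: ord_ge0.
Qed.

Lemma le_nu_loc (z : int) x t : t != 0 -> ord P t = z ->
  (z%:E <= nu P x)%E <-> loc (x / t).
Proof.
move=> t0 tz; rewrite nu_ge0 nuM ?invr_eq0// ordV// tz.
by case: (nu P x) => [k| |]/=; rewrite ?leey// !lee_fin subr_ge0.
Qed.

(** For finite [n], dividing by an element of order [n] reduces the claim to closure of [D_P] under
    addition. *)
Lemma le_nuD n x y : (n <= nu P x)%E -> (n <= nu P y)%E ->
  (n <= nu P (x + y)%R)%E.
Proof.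
case: n => [z| |] nx ny; last exact: leNye.
  have [t t0 tz] := exists_ord_eq z.
  apply/(le_nu_loc _ t0 tz); rewrite mulrDl.
  by apply: locD => //; apply/(le_nu_loc _ t0 tz).
have nu_oo w : (+oo <= nu P w)%E -> w = 0.
  by rewrite /nu; case: eqP.
by rewrite (nu_oo _ nx) (nu_oo _ ny) addr0 nu0.
Qed.

Lemma le_nuM (m n : int) x y :
  (m%:E <= nu P x -> n%:E <= nu P y -> (m + n)%R%:E <= nu P (x * y)%R)%E.
Proof.
have [->|x0] := eqVneq x 0; first by rewrite mul0r nu0 !leey.
have [->|y0] := eqVneq y 0; first by rewrite mulr0 nu0 !leey.
by rewrite !nuE ?mulf_neq0// ordM// !lee_fin; exact: lerD.
Qed.

Lemma le_nuZ n a x : (n <= nu P x)%E -> (n <= nu P (iota a * x)%R)%E.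
Proof.
have [->|a0] := eqVneq a 0; first by rewrite rmorph0 mul0r nu0 leey.
rewrite mulrC nuM ?tofrac_eq0// => /le_trans; apply.
by rewrite -[leLHS]adde0 leeD2l// lee_fin ord_iota_ge0.
Qed.

Definition nu_ge (n : \bar int) : set K := [set x | (n <= nu P x)%E].

Lemma nu_ge_submodule n : submodule (nu_ge n).
Proof.
split=> [|x y|a x]; rewrite /nu_ge /=; [by rewrite nu0 leey| |exact: le_nuZ].
exact: le_nuD.
Qed.

Lemma nu_ge_sub m n : nu_ge n `<=` nu_ge m -> (m <= n)%E.
Proof.
case: n => [z| |] nm; last 2 first.
- exact: leey.
- case: m nm => [k| |] nm //.
    have [x x0 xk] := exists_ord_eq (k - 1).
    have /nm : nu_ge -oo%E x by exact: leNye.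
    by rewrite /nu_ge /= nuE// xk lee_fin lerDl.
  have /nm : nu_ge -oo%E 1 by exact: leNye.
  by rewrite /nu_ge /= nuE ?oner_neq0.
have [x x0 xz] := exists_ord_eq z.
by have := nm x; rewrite /nu_ge /= nuE// xz; apply.
Qed.

Lemma nu_ge_inj : injective nu_ge.
Proof.
by move=> m n mn; apply/eqP; rewrite eq_le !nu_ge_sub// mn.
Qed.

(** The element [t ^+ n] of the power has the least possible order, and every element of at least
    that order is a multiple of it by an element of [D_P]. The values 1 and -1 of [k] serve the
    powers of [P] and of its inverse. *)
Lemma expm_loc (I : set K) (k : int) t n : I `<=` nu_ge k%:E%E ->
  I t -> t != 0 -> ord P t = k ->
  mulm (expm I n) loc = nu_ge (k * n%:Z)%:E%E.
Proof.
move=> Ik It t0 tk.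
have sub m : expm I m `<=` nu_ge (k * m%:Z)%:E%E.
  elim: m => [_ [a _ <-]|m IHm] /=.
    by rewrite mulr0; apply/nu_ge0; exact: loc_iota.
  apply: mulm_sub => [|x y /Ik xk /IHm ym]; first exact: nu_ge_submodule.
  by rewrite /nu_ge /= -addn1 addnC PoszD mulrDr mulr1; apply: le_nuM.
have mem m : expm I m (t ^+ m) /\ ord P (t ^+ m) = k * m%:Z.
  elim: m => [|m [Im om]] /=.
    by rewrite expr0 mulr0 ord_one; split=> //; exists 1; rewrite ?rmorph1.
  rewrite exprS ordM ?expf_neq0// tk om; split; first exact: mem_mulm.
  by rewrite -addn1 addnC PoszD mulrDr mulr1.
have [In on] := mem n; apply/seteqP; split.
  apply: mulm_sub => [|x y /sub xn /nu_ge0 y0]; first exact: nu_ge_submodule.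
  by rewrite /nu_ge /= -[_ * _ as X in X%:E%E]addr0; apply: le_nuM.
move=> x /(le_nu_loc _ (expf_neq0 _ t0) on) lx.
rewrite -[x](mulfVK (expf_neq0 n t0)) mulrC; exact: mem_mulm.
Qed.

Lemma nu_iota_ge1 a : P a -> (1%:E <= nu P (iota a))%E.
Proof.
move=> Pa; have [->|a0] := eqVneq a 0; first by rewrite rmorph0 nu0 leey.
rewrite nuE ?tofrac_eq0// lee_fin -gtz0_ge1 lt_neqAle ord_iota_ge0// andbT.
apply/eqP => oa; apply: (loc_inv_iota primeP a0 _ Pa); apply/ord_ge0.
  by rewrite invr_eq0 tofrac_eq0.
by rewrite ordV ?tofrac_eq0// -oa.
Qed.

Lemma locpowE n : locpow P n = nu_ge n.
Proof.
have [_ _ [pi Ppi [pi0 opi]] [x xP [x0 ox]]] := ordP.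
case: n => [[n|n]| |].
- have PP : iota @` P `<=` nu_ge 1%:E by move=> _ [a Pa <-]; exact: nu_iota_ge1.
  by rewrite [LHS](expm_loc n PP _ pi0 opi) ?mul1r//; exists pi.
- rewrite [LHS](@expm_loc _ (-1) x)// ?NegzE ?mulN1r// => y yP.
  (* Since [y * pi] lies in [D] and [pi] has order 1, the order of [y] is at least -1. *)
  have [a _ aE] := yP (iota pi) (ex_intro2 _ _ pi Ppi erefl).
  have [->|y0] := eqVneq y 0; first by rewrite /nu_ge /= nu0 leey.
  rewrite /nu_ge /= nuE// lee_fin -subr_ge0 opprK -opi -(ordM y0 pi0) -aE.
  by apply: ord_iota_ge0; rewrite -tofrac_eq0 aE mulf_neq0.
- apply/seteqP; split=> y /=; rewrite /nu_ge /=.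
    by move=> ->; rewrite nu0.
  by rewrite /nu; case: eqP.
- by apply/seteqP; split=> y //= _; rewrite /nu_ge /= leNye.
Qed.

Definition min_nu (I : set K) := infimum +oo%E [set nu P y | y in I].

Lemma le_min_nu n I : (n <= min_nu I)%E <-> forall y, I y -> (n <= nu P y)%E.
Proof.
split=> [/(bar_int_infimum [set nu P y | y in I]).1 nI y Iy|nI].
  by apply: nI; exists y.
by apply/(bar_int_infimum [set nu P y | y in I]).1 => _ [y Iy <-]; apply: nI.
Qed.

(** For nonzero [x], some [y] in [I] has order at most that of [x], or else [ord P x + 1] would be a
    lower bound. Then [x / y = a / s] with [s] outside [P], and [s * x = a * y] lies in [I]. *)
Lemma min_nu_mem I x : submodule I -> (min_nu I <= nu P x)%E ->
  exists2 s, ~ P s & I (iota s * x).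
Proof.
move=> [I0 _ IM]; have [->|x0] := eqVneq x 0.
  by exists 1; [exact: prime_idealN1|rewrite mulr0].
rewrite nuE// => Ix; have [y Iy yx] : exists2 y, I y & (nu P y <= (ord P x)%:E)%E.
  apply: contrapT => ny.
  suff : ((ord P x + 1)%R%:E <= min_nu I)%E.
    by move=> /le_trans/(_ Ix); rewrite lee_fin gerDl.
  apply/le_min_nu => y Iy; have : ~~ (nu P y <= (ord P x)%:E)%E.
    by apply/negP => yx; apply: ny; exists y.
  case: (nu P y) => [k| |]; rewrite ?leey ?leNye//.
  by rewrite !lee_fin -ltNge lezD1.
have y0 : y != 0 by apply/eqP => y0; rewrite y0 nu0 in yx.
rewrite nuE// lee_fin in yx.
have [a _ [s Ps axy]] : loc (x / y).
  by apply/ord_ge0; rewrite ?mulf_neq0 ?invr_eq0// ordM ?invr_eq0// ordV// subr_ge0.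
exists s => //; have s0 := prime_ideal_neq0 primeP Ps.
have -> : iota s * x = iota a * y; last exact: IM.
by rewrite -[x](mulfVK y0) -axy mulrA (mulrC (iota s)) mulfVK.
Qed.

Lemma mulm_loc I : submodule I -> mulm I loc = nu_ge (min_nu I).
Proof.
move=> sI; apply/seteqP; split.
  apply: mulm_sub => [|x y Ix [a _ [s Ps <-]]]; first exact: nu_ge_submodule.
  have s0 := prime_ideal_neq0 primeP Ps.
  rewrite /nu_ge /= mulrA mulrC mulrC nuM ?invr_eq0// ordV// ord_iota_eq0//.
  rewrite oppr0 adde0 mulrC; apply: le_nuZ.
  by move: x Ix; apply/le_min_nu.
move=> x /(min_nu_mem sI)[s Ps Isx]; have s0 := prime_ideal_neq0 primeP Ps.
by rewrite -[x](mulKf s0) mulrC; apply: mem_mulm => //; exact: locV.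
Qed.

(** The exponent [min_nu I] is admissible by [mulm_loc] and [locpowE], and unique by [nu_ge_inj]. *)
Lemma valuationE I : submodule I -> valuation P I = min_nu I.
Proof.
move=> sI; apply: xget_unique => /=.
  by rewrite mulm_loc// locpowE.
by move=> n; rewrite mulm_loc// locpowE => /nu_ge_inj.
Qed.

End LocalValuation.

End Valuation.

(** * Weak approximation and the coordinates of a submodule *)

Section Global.
Variable D : idomainType.
Hypotheses (dD : dedekind_domain D) (nF : ~ GRing.field_axiom D).
Local Notation K := {fraction D}.
Local Notation iota := (@tofrac D).
Implicit Types (a b r s : D) (x y : K) (p q : Max D).

Lemma max_valP p : maximal_ideal (\val p).
Proof. exact: set_mem (valP p). Qed.

Let primeP p : prime_ideal (\val p) := maximal_prime (max_valP p).

Lemma max_val_sub p (I : set D) : maximal_ideal I -> I `<=` \val p -> \val p = I.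
Proof.
move=> [_ _ maxI] Ip; have [idp pT _] := max_valP p.
by have [] := maxI _ idp Ip.
Qed.

Lemma adjoin_sub (I J : set D) a : ideal J -> I `<=` J -> J a ->
  adjoin I a `<=` J.
Proof.
move=> [_ JD JM] IJ Ja b [r Ib]; rewrite -(subrK (r * a) b).
by apply: JD; [exact: IJ|exact: JM].
Qed.

(* An ideal maximal among the nonzero ideals contained in infinitely many
   maximal ideals would be prime, hence maximal. *)
Lemma finite_max_above (I : set D) : ideal I -> I <> [set 0] ->
  finite_set [set p : Max D | I `<=` \val p].
Proof.
move=> idI I0; apply: contrapT => infI.
pose F := [set J : set D | [/\ ideal J, J <> [set 0] &
  ~ finite_set [set p : Max D | J `<=` \val p]]].
have nD : noetherian D by case: dD.
have [| |M [idM M0 infM] maxM] := @noetherian_max D F nD.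
- by move=> J [].
- by exists I.
apply: (infM).
have finM a : ~ M a -> finite_set [set p : Max D | adjoin M a `<=` \val p].
  move=> nMa; apply: contrapT => infa; apply: nMa.
  have <- : adjoin M a = M; last exact: mem_adjoin.
  apply: maxM; last exact: sub_adjoin.
  split=> //; first exact: adjoin_ideal.
  move=> a0; apply: M0; apply/seteqP; split=> [b Mb|_ ->]; last by case: idM.
  by rewrite -a0; exact: sub_adjoin.
have primeM : prime_ideal M.
  split=> // [MT|a b Mab].
    apply: infM; rewrite (_ : [set _ | _] = set0)//.
    apply/seteqP; split=> // p /=; rewrite MT => Tp.
    by case: (max_valP p) => _ + _; apply; apply/seteqP.
  (* A maximal ideal above [M] contains [a * b], hence [a] or [b], so it lies above one of two
     strictly larger ideals. *)
  apply: contrapT => /not_orP[Ma Mb]; apply: infM.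
  apply: (@sub_finite_set _ _ ([set p : Max D | adjoin M a `<=` \val p] `|`
    [set p : Max D | adjoin M b `<=` \val p])); last first.
    by rewrite finite_setU; split; exact: finM.
  move=> p /= Mp; have [idp _ _] := max_valP p.
  have [pa|pb] := (prime_ideal_mul a b (primeP p)).1 (Mp _ Mab).
    by left; exact: adjoin_sub.
  by right; exact: adjoin_sub.
have maxiM : maximal_ideal M by case: dD => _ _; apply.
apply: (@sub_finite_set _ _ [set exist _ M (mem_set maxiM) : Max D]).
  by move=> p /= /(max_val_sub maxiM) pM; apply: val_inj.
exact: finite_set1.
Qed.

Lemma finite_max_mem a : a != 0 -> finite_set [set p : Max D | \val p a].
Proof.
move=> a0; pose I := [set b | exists r, b = r * a].
have idI : ideal I.
  split=> [|_ _ [r ->] [s ->]|b _ [r ->]].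
  - by exists 0; rewrite mul0r.
  - by exists (r + s); rewrite mulrDl.
  - by exists (b * r); rewrite mulrA.
have I0 : I <> [set 0].
  move=> I0; have : I a by exists 1; rewrite mul1r.
  by rewrite I0 /= => aE; rewrite aE eqxx in a0.
apply: sub_finite_set (finite_max_above idI I0) => p /= pa _ [r ->].
by case: (max_valP p) => -[_ _ pM] _ _; exact: pM.
Qed.

(** The order of [a / b] vanishes at every maximal ideal containing neither [a] nor [b]. *)
Lemma finite_ord_neq0 x : x != 0 ->
  finite_set [set p : Max D | ord (\val p) x != 0].
Proof.
have [a [b [b0 ->]]] := fractionP x => ab0.
have a0 : a != 0 by apply: contra ab0 => /eqP->; rewrite rmorph0 mul0r.
apply: (@sub_finite_set _ _ ([set p : Max D | \val p a] `|`
    [set p : Max D | \val p b])); last first.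
  by rewrite finite_setU; split; exact: finite_max_mem.
move=> p /= /eqP ordp; have mp := max_valP p.
apply: contrapT => /not_orP[pa pb]; apply: ordp.
have a0' : iota a != 0 by rewrite tofrac_eq0.
have b0' : iota b != 0 by rewrite tofrac_eq0.
rewrite (ordM dD nF mp a0' (invr_neq0 b0')) (ordV dD nF mp b0').
by rewrite (ord_iota_eq0 dD nF mp pa) (ord_iota_eq0 dD nF mp pb) subr0.
Qed.

Lemma ordXn p x n : x != 0 -> ord (\val p) (x ^+ n) = ord (\val p) x *+ n.
Proof.
move=> x0; have mp := max_valP p; elim: n => [|n IHn].
  exact: (ord_one dD nF mp).
by rewrite exprS mulrS (ordM dD nF mp x0 (expf_neq0 _ x0)) IHn.
Qed.

(** Each [q] in [l] other than [p] contains some [c] outside [p]. The product of the powers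
    [c ^+ N q] stays outside the prime [p], and further factors from [D] never lower an order. *)
Lemma prime_avoidance p (l : seq (Max D)) (N : Max D -> nat) :
  exists2 s, ~ \val p s &
    forall q, q \in l -> q <> p -> (N q)%:Z <= ord (\val q) (iota s).
Proof.
elim: l => [|q l [s ps sl]].
  by exists 1 => //; exact: prime_idealN1 (primeP p).
have [->|/eqP qp] := eqVneq q p.
  by exists s => // q'; rewrite inE => /predU1P[//|]; exact: sl.
have [c qc pc] : exists2 c, \val q c & ~ \val p c.
  apply: contrapT => nc; apply: qp; apply/esym/val_inj.
  apply: (max_val_sub (max_valP q)) => c qc; apply: contrapT => pc.
  by apply: nc; exists c.
have nz (d : D) : ~ \val p d -> d != 0.
  by move=> /(prime_ideal_neq0 (primeP p)); rewrite tofrac_eq0.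
have c0 := nz _ pc; have s0 := nz _ ps.
have c0' : iota c != 0 by rewrite tofrac_eq0.
have s0' : iota s != 0 by rewrite tofrac_eq0.
have pcn n : ~ \val p (c ^+ n).
  elim: n => [|n IHn]; first exact: prime_idealN1 (primeP p).
  by rewrite exprS; apply: prime_idealNM.
have ordE q' : ord (\val q') (iota (c ^+ N q * s)) =
    ord (\val q') (iota c) *+ N q + ord (\val q') (iota s).
  rewrite rmorphM rmorphXn.
  by rewrite (ordM dD nF (max_valP q') (expf_neq0 _ c0') s0') ordXn.
exists (c ^+ N q * s); first exact: prime_idealNM.
move=> q' q'l q'p; rewrite ordE.
have oc := ord_iota_ge0 dD nF (max_valP q') c0.
have os := ord_iota_ge0 dD nF (max_valP q') s0.
move: q'l; rewrite inE => /predU1P[q'q|q'l]; last first.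
  by apply: le_trans (sl _ q'l q'p) _; rewrite lerDr mulrn_wge0.
have oc1 : 1 <= ord (\val q') (iota c).
  have : (1%:E <= nu (\val q') (iota c))%E.
    by apply: (nu_iota_ge1 dD nF (max_valP q')); rewrite q'q.
  by rewrite (nuE _ c0') lee_fin.
rewrite q'q in oc os oc1 *.
apply: le_trans (_ : _ <= ord (\val q) (iota c) *+ N q) _.
  by rewrite -[leLHS]natz lerMn2r oc1 orbT.
by rewrite lerDl.
Qed.

(** Start from [t] of order [h p] at [p]. A factor [s] outside [p] corrects the finitely many [q]
    where [h] is positive or [t] has nonzero order; at other [q] the order of [s * t] is that of
    [s], which is at least 0 and so at least [h q]. *)
Lemma approximation p (h : Max D -> int) : finite_set [set q | 0 < h q] ->
  exists y, [/\ y != 0, ord (\val p) y = h p & forall q, h q <= ord (\val q) y].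
Proof.
move=> finh; have [t t0 tp] := exists_ord_eq dD nF (max_valP p) (h p).
have /finite_seqP[l lE] : finite_set
    ([set q | 0 < h q] `|` [set q : Max D | ord (\val q) t != 0]).
  by rewrite finite_setU; split=> //; exact: finite_ord_neq0.
have [s ps sl] := prime_avoidance p l (fun q => `|h q - ord (\val q) t|%N).
have s0' := prime_ideal_neq0 (primeP p) ps.
have s0 : s != 0 by rewrite -tofrac_eq0.
have op : ord (\val p) (iota s * t) = h p.
  rewrite (ordM dD nF (max_valP p) s0' t0).
  by rewrite (ord_iota_eq0 dD nF (max_valP p) ps) tp add0r.
exists (iota s * t); split=> [||q]; [exact: mulf_neq0| exact: op|].
have [->|/eqP qp] := eqVneq q p; first by rewrite op.
rewrite (ordM dD nF (max_valP q) s0' t0).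
have [ql|ql] := boolP (q \in l).
  rewrite -lerBlDr; apply: le_trans (sl _ ql qp).
  by rewrite abszE; exact: ler_norm.
have : ~ [set` l] q by apply/negP.
rewrite -lE => /not_orP[/negP h0 /negP]; rewrite negbK => /eqP->.
rewrite addr0; apply: le_trans (ord_iota_ge0 dD nF (max_valP q) s0).
by rewrite leNgt.
Qed.

Lemma bracketE (f : Max D -> \bar int) :
  bracket f = [set x | forall p, (- f p <= nu (\val p) x)%E].
Proof.
apply/seteqP; split=> x fx p; last move=> _; have := fx p.
  by rewrite (locpowE dD nF (max_valP p)); apply.
by rewrite (locpowE dD nF (max_valP p)).
Qed.

Lemma bracket_submodule (f : Max D -> \bar int) : submodule (bracket f).
Proof.
have sub p := nu_ge_submodule dD nF (max_valP p) (- f p)%E.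
rewrite bracketE; split=> [p|x y fx fy p|a x fx p].
- by case: (sub p).
- by case: (sub p) => _ + _; apply; [exact: fx|exact: fy].
- by case: (sub p) => _ _; apply; exact: fx.
Qed.

Lemma bracket_ord (f : Max D -> \bar int) p (z : int) : Zfun (Max D) f ->
  (- f p <= z%:E)%E -> exists y, [/\ bracket f y, y != 0 & ord (\val p) y = z].
Proof.
(* Where [f q] is [+oo], [fine] gives 0; this is harmless, since [- f q = -oo] imposes no
   condition. *)
move=> [fNy finf] fz; pose h q := if q == p then z else - fine (f q).
have [|y [y0 yp yh]] := @approximation p h.
  apply: (@sub_finite_set _ _ ([set p] `|` [set q | (f q < 0)%E])); last first.
    by rewrite finite_setU; split=> //; exact: finite_set1.
  move=> q /=; rewrite /h; case: eqP => [->|_]; [by left|right].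
  by case: (f q) H => [k| |] //=; rewrite oppr_gt0 lte_fin.
exists y; split=> //; last by rewrite yp /h eqxx.
rewrite bracketE => q; rewrite (nuE _ y0).
have := yh q; rewrite /h; case: eqP => [-> zy|_].
  by apply: le_trans fz _; rewrite lee_fin.
by case fq : (f q) => [k| |] /= hq; rewrite ?lee_fin ?leNye//; case: (fNy q).
Qed.

Lemma bracket_Kmod f : Zfun (Max D) f -> Kmod D (bracket f).
Proof.
move=> Zf; have [P maxP] := exists_max dD nF.
pose p : Max D := exist _ P (mem_set maxP).
have [y [fy y0 _]] : exists y, [/\ bracket f y, y != 0 &
    ord (\val p) y = - fine (f p)].
  apply: (bracket_ord Zf).
  by case fp : (f p) => [k| |] /=; rewrite ?lexx ?leNye//; case: (Zf.1 p).
exact: KmodI (bracket_submodule f) fy y0.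
Qed.

Lemma min_nu_bracket f p : Zfun (Max D) f ->
  min_nu (\val p) (bracket f) = (- f p)%E.
Proof.
move=> Zf; apply/eqP; rewrite eq_le; apply/andP; split; last first.
  by apply/le_min_nu => y; rewrite bracketE; apply.
have le_z (z : int) : (- f p <= z%:E)%E ->
    (min_nu (\val p) (bracket f) <= z%:E)%E.
  move=> /(bracket_ord Zf)[y [fy y0 <-]]; rewrite -(nuE _ y0).
  by move: (lexx (min_nu (\val p) (bracket f))) => /le_min_nu; apply.
case fp : (f p) le_z => [k| |] le_z; [exact: le_z| |by case: (Zf.1 p)].
(* Here [f p = +oo], so [le_z] holds for every integer, which leaves only [-oo]. *)
case: (min_nu _ _) le_z => [k| |] // le_z.
  by have := le_z (k - 1) (leNye _); rewrite lee_fin lerBrDl gerDr.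
by have := le_z 0 (leNye _).
Qed.

(** The inverse of [bracket], whose exponents are [- f p]. *)
Definition coordinates (I : set K) : Max D -> \bar int :=
  fun p => (- valuation (\val p) I)%E.

Lemma coordinatesE I p : submodule I ->
  coordinates I p = (- min_nu (\val p) I)%E.
Proof.
by move=> sI; rewrite /coordinates (valuationE dD nF (max_valP p) sI).
Qed.

Lemma coordinatesK f : Zfun (Max D) f -> coordinates (bracket f) = f.
Proof.
move=> Zf; apply/funext => p; rewrite coordinatesE; last exact: bracket_submodule.
by rewrite min_nu_bracket// oppeK.
Qed.

(** A nonzero [x] in [I] bounds the coordinates below by [- ord x], which vanishes almost
    everywhere. *)
Lemma Zfun_coordinates I : Kmod D I -> Zfun (Max D) (coordinates I).
Proof.
move=> KI; have [x Ix x0] := Kmod_nonzero KI; have sI := KI.1.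
have Ixp p : (min_nu (\val p) I <= (ord (\val p) x)%:E)%E.
  rewrite -(nuE _ x0).
  by move: (lexx (min_nu (\val p) I)) => /le_min_nu; apply.
split=> [p|].
  by rewrite coordinatesE//; case: (min_nu _ _) (Ixp p).
apply: sub_finite_set (finite_ord_neq0 x0) => p /=.
rewrite coordinatesE// oppe_lt0 => /lt_le_trans/(_ (Ixp p)).
by rewrite lte_fin => /lt0r_neq0.
Qed.

(** If [x] satisfies all local conditions, [min_nu_mem] shows that no maximal ideal contains the
    ideal [J] of the [a] with [a * x] in [I]; so 1 lies in [J]. *)
Lemma bracketK I : Kmod D I -> bracket (coordinates I) = I.
Proof.
move=> KI; have sI := KI.1; rewrite bracketE; apply/seteqP; split=> x.
  move=> Ix; have [I0 ID IM] := sI.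
  pose J := [set a | I (iota a * x)].
  have idJ : ideal J.
    split=> [|a b Ja Jb|a b Jb]; rewrite /J /=.
    - by rewrite rmorph0 mul0r.
    - by rewrite rmorphD mulrDl; exact: ID.
    - by rewrite rmorphM -mulrA; exact: IM.
  suff : J 1 by rewrite /J /= rmorph1 mul1r.
  apply: contrapT => J1; have nD : noetherian D by case: dD.
  have [|P maxP JP] := exists_maximal_ideal nD idJ.
    by move=> JT; apply: J1; rewrite JT.
  pose p : Max D := exist _ P (mem_set maxP).
  have := Ix p; rewrite coordinatesE// oppeK.
  by move=> /(min_nu_mem dD nF (max_valP p) sI)[s ps /JP].
move=> Ix p; rewrite coordinatesE// oppeK.
by move: x Ix; apply/le_min_nu.
Qed.

Lemma bracket_inj f g : Zfun (Max D) f -> Zfun (Max D) g ->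
  bracket f = bracket g -> f = g.
Proof. by move=> Zf Zg fg; rewrite -(coordinatesK Zf) fg coordinatesK. Qed.

End Global.

(** * Semistar operations *)

Section SemistarFamilies.
Variable D : idomainType.
Local Notation K := {fraction D}.
Local Notation iota := (@tofrac D).
Implicit Types (x y : K) (I J : set K) (C G : set (set K)).

Definition scalem x I : set K := [set x * y | y in I].

Lemma scalem_submodule x I : submodule I -> submodule (scalem x I).
Proof.
move=> [I0 ID IM]; split=> [|_ _ [y Iy <-] [z Iz <-]|a _ [y Iy <-]].
- by exists 0; rewrite ?mulr0.
- by exists (y + z); [exact: ID|rewrite mulrDr].
- by exists (iota a * y); [exact: IM|rewrite mulrCA].
Qed.

Lemma scalem_Kmod x I : x != 0 -> Kmod D I -> Kmod D (scalem x I).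
Proof.
move=> x0 KI; have [y Iy y0] := Kmod_nonzero KI.
apply: (@KmodI _ _ (x * y)); [|by exists y|exact: mulf_neq0].
by apply: scalem_submodule; case: KI.
Qed.

Lemma range_Kmod : Kmod D (range iota).
Proof.
apply: (@KmodI _ _ 1); [|by exists 1; rewrite ?rmorph1|exact: oner_neq0].
split=> [|_ _ [a _ <-] [b _ <-]|a _ [b _ <-]].
- by exists 0; rewrite ?rmorph0.
- by exists (a + b); rewrite ?rmorphD.
- by exists (a * b); rewrite ?rmorphM.
Qed.

Lemma mulm_scalemV x I : x != 0 -> submodule I ->
  mulm (scalem x^-1 (range iota)) (scalem x I) = I.
Proof.
move=> x0 sI; apply/seteqP; split.
  apply: mulm_sub => // _ _ [_ [a _ <-] <-] [y Iy <-].
  by rewrite mulrACA mulVf// mul1r; case: sI => _ _; apply.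
move=> y Iy; rewrite -[y](mulKf x0); apply: mem_mulm; last by exists y.
by exists 1; [exists 1; rewrite ?rmorph1|rewrite mulr1].
Qed.

(** Stability under multiples comes from the product rule applied to [x^-1 D] and [x I]. Conversely,
    intersecting the members of [C] above [I] defines [star I]. The empty [G] is allowed, so [K]
    belongs to [C]. *)
Lemma MK_closedP C : MK D C <->
  [/\ C `<=` Kmod D,
      forall G, G `<=` C -> Kmod D (\bigcap_(I in G) I) ->
        C (\bigcap_(I in G) I) &
      forall x I, x != 0 -> C I -> C (scalem x I)].
Proof.
split=> [[star [[starK star_ge starS star_id] starM] ->]|[CK Ccap Cscale]].
  have closed I : (star @` Kmod D) I <-> Kmod D I /\ star I = I.
    split=> [[J KJ <-]|[KI <-]]; last by exists I.
    by split; [exact: starK|exact: star_id].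
  have leS I J : Kmod D I -> Kmod D J -> I `<=` J -> star I `<=` star J.
    by move=> KI KJ; rewrite -!subsetEset; exact: starS.
  have sub I : Kmod D I -> I `<=` star I.
    by move=> KI; rewrite -subsetEset; exact: star_ge.
  split=> [I /closed[]//|G GC KG|x I x0 /closed[KI starI]]; apply/closed.
    split=> //; apply/seteqP; split; last exact: sub.
    move=> x Gx I GI; have [KI <-] := (closed I).1 (GC _ GI).
    by apply: leS Gx => //; exact: bigcap_inf.
  have KxI := scalem_Kmod x0 KI; split=> //.
  apply/seteqP; split; last exact: sub.
  move=> y xIy; exists (x^-1 * y); last by rewrite mulVKf.
  have KxD := scalem_Kmod (invr_neq0 x0) range_Kmod.
  (* The product of the closures of [x^-1 D] and [x I] lies in [star I = I], so [x^-1] maps the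
     closure of [x I] into [I]. *)
  rewrite -starI -[in star I](mulm_scalemV x0 KI.1).
  apply: (starM _ _ KxD KxI); apply: mem_mulm xIy.
  apply: sub KxD _ _.
  by exists 1; [exists 1; rewrite ?rmorph1|rewrite mulr1].
pose star I := \bigcap_(J in [set J | C J /\ I `<=` J]) J.
have star_le I J : C J -> I `<=` J -> star I `<=` J.
  by move=> CJ IJ x; apply.
have sub I : I `<=` star I by move=> x Ix J [_]; apply.
have starC I : Kmod D I -> C (star I).
  move=> KI; have [x Ix x0] := Kmod_nonzero KI; apply: Ccap => [J []//|].
  apply: (@KmodI _ _ x) => //; last exact: sub.
  by apply: submodule_bigcap => J [/CK[]].
have starE I : C I -> star I = I.
  by move=> CI; apply/seteqP; split; [exact: star_le|exact: sub].
exists star; last first.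
  apply/seteqP; split=> [I CI|_ [I KI <-]]; last exact: starC.
  by exists I; [exact: CK|exact: starE].
split; first split.
- by move=> I /starC /CK.
- by move=> I _; rewrite subsetEset; exact: sub.
- move=> I J _ KJ; rewrite !subsetEset => IJ; apply: star_le (starC _ KJ) _.
  exact: subset_trans IJ (sub _).
- by move=> I /starC; exact: starE.
move=> I J KI KJ; set L := mulm I J.
have [x Ix x0] := Kmod_nonzero KI; have [y Jy y0] := Kmod_nonzero KJ.
have KL : Kmod D L.
  apply: (@KmodI _ _ (x * y)); [|exact: mem_mulm|exact: mulf_neq0].
  by apply: submodule_bigcap => M [].
have CL := starC _ KL.
have sL : submodule (star L) by case: (CK _ CL).
(* For nonzero [j] in [J], the multiple [j^-1 star L] belongs to [C] and contains [I], hence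
   [star I]. The same argument then replaces [J] by [star J]. *)
have IL i j : star I i -> J j -> star L (i * j).
  move=> Ii Jj; have [->|j0] := eqVneq j 0; first by rewrite mulr0; case: sL.
  have [||z Lz <-] := star_le I (scalem j^-1 (star L)) _ _ _ Ii.
  - by apply: Cscale => //; rewrite invr_eq0.
  - move=> z Iz; exists (j * z); last by rewrite mulKf.
    by apply: sub; rewrite mulrC; exact: mem_mulm.
  by rewrite mulrAC mulVf// mul1r.
apply: mulm_sub => // i j Ii Jj.
have [->|i0] := eqVneq i 0; first by rewrite mul0r; case: sL.
have [||z Lz <-] := star_le J (scalem i^-1 (star L)) _ _ _ Jj.
- by apply: Cscale => //; rewrite invr_eq0.
- by move=> z Jz; exists (i * z); [exact: IL|rewrite mulKf].
by rewrite mulVKf.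
Qed.

End SemistarFamilies.

(** * Semistar families in terms of functions *)

Section Semistar.
Variable D : idomainType.
Hypotheses (dD : dedekind_domain D) (nF : ~ GRing.field_axiom D).
Local Notation K := {fraction D}.
Local Notation iota := (@tofrac D).
Implicit Types (x y : K) (p q : Max D).

(** Multiplication by [x] adds [ord x] to valuations, hence subtracts it from coordinates. *)
Definition shift x (f : Max D -> \bar int) : Max D -> \bar int :=
  fun p => (f p - (ord (\val p) x)%:E)%E.

Lemma bracket_shift x f : x != 0 -> bracket (shift x f) = scalem x (bracket f).
Proof.
move=> x0; rewrite !(bracketE dD nF).
have shiftE y p : (- shift x f p <= nu (\val p) (x * y)%R)%E =
    (- f p <= nu (\val p) y)%E.
  rewrite mulrC (nuM dD nF (max_valP p) _ x0) /shift.
  case: (f p) => [k| |]; case: (nu (\val p) y) => [m| |]//=; rewrite ?leey ?leNye//.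
  by rewrite !lee_fin opprB addrC lerD2l.
apply/seteqP; split=> [y fy|_ [y fy <-] p]; last by rewrite shiftE.
exists (x^-1 * y); last by rewrite mulVKf.
by move=> p; rewrite -shiftE mulVKf.
Qed.

Lemma Zfun_shift x f : x != 0 -> Zfun (Max D) f -> Zfun (Max D) (shift x f).
Proof.
move=> x0 [fNy finf]; split=> [p|].
  by rewrite /shift; have := fNy p; case: (f p).
apply: (@sub_finite_set _ _ ([set p | (f p < 0)%E] `|`
    [set p : Max D | ord (\val p) x != 0])); last first.
  by rewrite finite_setU; split=> //; exact: finite_ord_neq0.
move=> p /=; rewrite /shift.
have [->|o0] := eqVneq (ord (\val p) x) 0; last by right.
by rewrite sube0 => f0; left.
Qed.

Lemma preceq_shift x f : x != 0 -> preceq (shift x f) f.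
Proof.
move=> x0; split=> [|p]; last by rewrite /shift; case: (f p).
apply: sub_finite_set (finite_ord_neq0 dD nF x0) => p /=.
apply: contra => /eqP o0; by rewrite /shift o0 sube0.
Qed.

(** Some [y] has order [g - f] at [p] and at least [g - f] wherever this is finite; shifting [f] by
    [y^-1] adds [ord y]. As [g] exceeds [f] only finitely often, [approximation] applies. *)
Lemma preceq_inf_shift X g f : X f -> Zfun (Max D) f -> Zfun (Max D) g ->
  preceq g f -> (forall x, x != 0 -> X (shift x f)) -> inf_closure X g.
Proof.
move=> Xf Zf Zg [gf gfy] Xs; apply/inf_closureP; split=> // p z gp.
(* Both functions are [+oo] at the same points, where [h] becomes 0. *)
pose h q := fine (g q) - fine (f q).
have [|y [y0 yp yh]] := @approximation D dD nF p h.
  apply: sub_finite_set gf => q /=; rewrite /h subr_gt0.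
  case gq : (g q) => [m| |]; last by case: (Zg.1 q).
    case fq : (f q) => [k| |]; last by case: (Zf.1 q).
      by rewrite lee_fin -ltNge.
    by rewrite ((gfy q).2 fq) in gq.
  by rewrite ((gfy q).1 gq).
exists (shift y^-1 f); split; first by apply: Xs; rewrite invr_eq0.
  move=> q; rewrite /shift (ordV dD nF (max_valP q) y0).
  have := yh q; rewrite /h.
  case gq : (g q) => [m| |]; last by case: (Zg.1 q).
    case fq : (f q) => [k| |]; last by case: (Zf.1 q).
      by rewrite /= lee_fin opprK lerBlDl.
    by rewrite ((gfy q).2 fq) in gq.
  by rewrite ((gfy q).1 gq).
rewrite /shift (ordV dD nF (max_valP p) y0) yp /h gp /=.
case fp : (f p) => [k| |] /=; last by case: (Zf.1 p).
  by rewrite opprK -EFinD (addrC k) subrK.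
by rewrite ((gfy p).2 fp) in gp.
Qed.

Lemma MK_bracketP X : X `<=` Zfun (Max D) ->
  MK D (@bracket D @` X) <-> preceq_closure X `<=` X /\ inf_closure X `<=` X.
Proof.
move=> XZ; split=> [/MK_closedP[_ Xcap Xscale]|[pX iX]].
  have memX g : Zfun (Max D) g -> (@bracket D @` X) (bracket g) -> X g.
    by move=> Zg [f Xf /(bracket_inj dD nF (XZ _ Xf) Zg) <-].
  have iX : inf_closure X `<=` X.
    move=> g [Zg [Y YX gE]]; apply: memX => //.
    have bE : bracket g = \bigcap_(I in @bracket D @` Y) I.
      rewrite (bracketE dD nF); apply/seteqP; split=> x.
        move=> gx _ [f Yf <-]; rewrite (bracketE dD nF) => p.
        apply: le_trans (gx p); rewrite leeN2 gE.
        exact: ((le_finf Y p _).1 (lexx _) f Yf).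
      move=> Yx p; rewrite leeNl gE; apply/le_finf => f Yf.
      have : bracket f x by apply: Yx; exists f.
      by rewrite (bracketE dD nF) leeNl; apply.
    rewrite bE; apply: Xcap; last by rewrite -bE; exact: bracket_Kmod.
    by move=> _ [f Yf <-]; exists f => //; exact: YX.
  (* Stability under multiples puts all shifts of [f] in [X], and [g] is an infimum of such
     shifts. *)
  split=> // g [Zg [f Xf gf]]; apply/iX/(preceq_inf_shift Xf) => //.
    exact: XZ.
  move=> x x0; apply: memX; first exact: Zfun_shift (XZ _ Xf).
  by rewrite bracket_shift//; apply: Xscale => //; exists f.
apply/MK_closedP; split=> [_ [f /XZ Zf <-]|G GX KG|x _ x0 [f Xf <-]].
- exact: bracket_Kmod.
- pose Y := [set f | X f /\ G (bracket f)].
  have GE : \bigcap_(I in G) I = bracket (finf Y).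
    rewrite (bracketE dD nF); apply/seteqP; split=> x.
      move=> Gx p; rewrite leeNl; apply/le_finf => f [_ /Gx].
      by rewrite (bracketE dD nF) leeNl; apply.
    move=> Yx I GI; have [f Xf fI] := GX _ GI.
    rewrite -fI (bracketE dD nF) => p; rewrite leeNl.
    have Yxp := Yx p; rewrite leeNl in Yxp.
    by apply: ((le_finf Y p _).1 Yxp f); split=> //; rewrite fI.
  (* A nonzero [x] in the intersection bounds the infimum below by [- ord x], so only finitely many
     values are negative. *)
  have ZY : Zfun (Max D) (finf Y).
    have [x] := Kmod_nonzero KG; rewrite GE (bracketE dD nF) => Yx x0.
    have Yp p : ((- ord (\val p) x)%R%:E <= finf Y p)%E.
      by have := Yx p; rewrite leeNl (nuE _ x0).
    split=> [p Yy|]; first by have := Yp p; rewrite Yy.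
    apply: sub_finite_set (finite_ord_neq0 dD nF x0) => p /=.
    move=> /(le_lt_trans (Yp p)); rewrite lte_fin oppr_lt0.
    by move=> /lt0r_neq0.
  rewrite GE; exists (finf Y) => //; apply: iX; split=> //.
  by exists Y => // f [].
- exists (shift x f); last exact: bracket_shift.
  apply: pX; split; first exact: Zfun_shift (XZ _ Xf).
  by exists f => //; exact: preceq_shift.
Qed.

Lemma bracket_coordinates (C : set (set K)) : MK D C ->
  @bracket D @` (@coordinates D @` C) = C.
Proof.
move=> /MK_closedP[CK _ _]; apply/seteqP; split=> [_ [_ [I CI <-] <-]|I CI].
  by rewrite bracketK//; exact: CK.
by exists (coordinates I); [exists I|rewrite bracketK//; exact: CK].
Qed.

Lemma coordinates_bracket X : X `<=` Zfun (Max D) ->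
  @coordinates D @` (@bracket D @` X) = X.
Proof.
move=> XZ; apply/seteqP; split=> [_ [_ [f Xf <-] <-]|f Xf].
  by rewrite coordinatesK//; exact: XZ.
by exists (bracket f); [exists f|rewrite coordinatesK//; exact: XZ].
Qed.

End Semistar.

(** * The closure operation and the isomorphism of posets *)

Theorem theorem3p4 (D : idomainType) (hD : dedekind_domain D)
    (hF : ~ GRing.field_axiom D) :
  let Z := Zfun (Max D) in
  let pZ := [set X | X `<=` Z] in
  let dag := @dagger (Max D) in
  [/\ forall X, X `<=` Z ->
        [/\ dag X `<=` Z, X `<=` dag X, MK D (@bracket D @` dag X) &
            forall W, W `<=` Z -> X `<=` W -> MK D (@bracket D @` W) ->
              dag X `<=` W],
      closure_operation pZ dag,
      forall X, X `<=` Z ->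
        ((dag @` pZ) X <-> preceq_closure X `<=` X /\ inf_closure X `<=` X) &
      [/\ poset_isomorphism (dag @` pZ) (MK D) (fun X => @bracket D @` X),
          forall X, (dag @` pZ) X ->
            @bracket D @` X =
            [set \bigcap_(p : Max D) locpow (\val p) (- f p)%E | f in X] &
          inverse_on (dag @` pZ) (MK D) (fun X => @bracket D @` X)
            (fun C =>
              [set (fun p : Max D => - valuation (\val p) I)%E | I in C])]].
Proof.
move=> Z pZ dag.
(* Both sides are characterized by the same two stability conditions. *)
have MK_dag X : X `<=` Z -> MK D (@bracket D @` X) <-> (dag @` pZ) X.
  move=> XZ; rewrite (MK_bracketP hD hF XZ).
  exact: iff_sym (range_daggerP XZ).
have dagZ X : (dag @` pZ) X -> X `<=` Z by move=> [Y _ <-]; exact: dagger_subZ.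
have coordZ C : MK D C -> @coordinates D @` C `<=` Z.
  move=> /MK_closedP[CK _ _] _ [I CI <-]; apply: Zfun_coordinates => //.
  exact: CK.
have dag_coord C : MK D C -> (dag @` pZ) (@coordinates D @` C).
  by move=> MC; apply/MK_dag; [exact: coordZ|rewrite bracket_coordinates].
have MK_bracket X : (dag @` pZ) X -> MK D (@bracket D @` X).
  by move=> dX; apply/MK_dag => //; exact: dagZ.
split.
- move=> X XZ; split; [exact: dagger_subZ|exact: sub_dagger| |].
    by apply: MK_bracket; exists X.
  by move=> W WZ XW /(MK_bracketP hD hF WZ)[]; exact: dagger_min.
- exact: dagger_closure.
- by move=> X XZ; exact: range_daggerP.
split=> //; last first.
  split=> [C MC|X dX|C MC].
  - exact: dag_coord.
  - by apply: (coordinates_bracket hD hF); exact: dagZ.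
  - exact: (bracket_coordinates hD hF).
split=> [|X Y dX dY].
  split=> [X dX|X Y /set_mem dX /set_mem dY XY|C MC].
  - exact: MK_bracket.
  - rewrite -(coordinates_bracket hD hF (dagZ _ dX)) XY.
    by rewrite (coordinates_bracket hD hF (dagZ _ dY)).
  - by exists (@coordinates D @` C); [exact: dag_coord|exact: bracket_coordinates].
rewrite !subsetEset; split=> [|bXY]; first exact: image_subset.
(* Taking images under [coordinates] recovers the inclusion of [X] in [Y]. *)
rewrite -(coordinates_bracket hD hF (dagZ _ dX)).
rewrite -(coordinates_bracket hD hF (dagZ _ dY)).
exact: image_subset.
Qed.
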